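(* Let $(\alpha,\beta,\gamma,\delta)\in\mathbb C^4$ with $(\alpha,\beta,\gamma,\delta)\neq(0,0,0,\tfrac12)$. Then the Painlevé VI equation $$y''=\tfrac12\left(\tfrac1y+\tfrac1{y-1}+\tfrac1{y-x}\right)(y')^2-\left(\tfrac1x+\tfrac1{x-1}+\tfrac1{y-x}\right)y'+\frac{y(y-1)(y-x)}{x^2(x-1)^2}\left(\alpha+\frac{\beta x}{y^2}+\frac{\gamma(x-1)}{(y-1)^2}+\frac{\delta x(x-1)}{(y-x)^2}\right)$$ is not locally foliated: there is no point $p\in\Omega=\mathbb C^2\setminus\{xy(x-1)(y-1)(y-x)=0\}$ having an open neighborhood on which the projective structure defined by this equation is foliated.
   Context: An equation $y''=A+B\,y'+C\,(y')^2+D\,(y')^3$ with $A,B,C,D$ holomorphic on an open set $U\subset\mathbb C^2$ with coordinates $(x,y)$ defines a projective structure $\Pi$ on $U$. Its geodesic foliation $\mathcal G$ on the projectivized tangent bundle $\mathbb P(T_U)\simeq U\times\mathbb P^1_z$, $z=\frac{dy}{dx}$, is given by the vector field $\partial_x+z\partial_y+(A+Bz+Cz^2+Dz^3)\partial_z$. $\Pi$ is foliated on $U$ if there are holomorphic $1$-forms $\alpha_0,\beta_0,\gamma_0$ on $U$ such that the Riccati equation $dz=\alpha_0z^2+\beta_0z+\gamma_0$ is Frobenius integrable on $\mathbb P(T_U)$ (i.e. $\omega\wedge d\omega=0$ for $\omega=dz-\alpha_0z^2-\beta_0z-\gamma_0$) and the intersection of the resulting Riccati foliation with the contact distribution $dy-z\,dx=0$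 is $\mathcal G$, i.e. substituting $z=\frac{dy}{dx}$ in the Riccati equation gives the second order equation defining $\Pi$. The value $(0,0,0,\frac12)$ is called the Picard parameter. *)

(* Defs.v *)
(* Stdlib reals with Coquelicot's complex numbers [C]. *)
From Stdlib Require Import Reals.
From Coquelicot Require Import Coquelicot.
Open Scope C_scope.

(* Complex (Frechet) differentiability: the differential is C-linear because
   the scalar ring is [C_AbsRing]. *)
Definition holomorphic_on (U : C * C -> Prop) (f : C * C -> C) : Prop :=
  forall p, U p -> ex_filterdiff (K := C_AbsRing) f (locally p).

(* The equation y'' = A + B y' + C (y')^2 + D (y')^3. *)
Record projective_structure := ProjectiveStructure {
  coefA : C * C -> C;
  coefB : C * C -> C;
  coefC : C * C -> C;
  coefD : C * C -> C
}.

Definition second_order_rhs (Pi : projective_structure) (p : C * C) (z : C) : C :=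
  coefA Pi p + coefB Pi p * z + coefC Pi p * z ^ 2 + coefD Pi p * z ^ 3.

Record one_form2 := OneForm2 { form_dx : C * C -> C; form_dy : C * C -> C }.

Definition holomorphic_form_on (U : C * C -> Prop) (eta : one_form2) : Prop :=
  holomorphic_on U (form_dx eta) /\ holomorphic_on U (form_dy eta).

(* The affine chart of P(T_U) has coordinates (x, y, z), z = dy/dx, and a point
   is written ((x, y), z).  Every condition imposed below on the fibre is
   polynomial in z, so it also holds on z = infinity by continuity. *)
Record one_form3 := OneForm3 {
  form3_dx : C * C * C -> C;
  form3_dy : C * C * C -> C;
  form3_dz : C * C * C -> C
}.

(* Coefficients on dx/\dy, dx/\dz, dy/\dz. *)
Record two_form3 := TwoForm3 {
  form3_dxdy : C * C * C -> C;
  form3_dxdz : C * C * C -> C;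
  form3_dydz : C * C * C -> C
}.

(* [C_derive] is total; it is the complex derivative wherever that exists. *)
Definition partial_x (F : C * C * C -> C) : C * C * C -> C :=
  fun '(x, y, z) => C_derive (fun t => F (t, y, z)) x.
Definition partial_y (F : C * C * C -> C) : C * C * C -> C :=
  fun '(x, y, z) => C_derive (fun t => F (x, t, z)) y.
Definition partial_z (F : C * C * C -> C) : C * C * C -> C :=
  fun '(x, y, z) => C_derive (fun t => F (x, y, t)) z.

Definition exterior_derivative (w : one_form3) : two_form3 :=
  TwoForm3
    (fun m => partial_x (form3_dy w) m - partial_y (form3_dx w) m)
    (fun m => partial_x (form3_dz w) m - partial_z (form3_dx w) m)
    (fun m => partial_y (form3_dz w) m - partial_z (form3_dy w) m).

(* Coefficient of w /\ eta on dx/\dy/\dz. *)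
Definition wedge (w : one_form3) (eta : two_form3) (m : C * C * C) : C :=
  form3_dx w m * form3_dydz eta m
  - form3_dy w m * form3_dxdz eta m
  + form3_dz w m * form3_dxdy eta m.

Definition frobenius_integrable_over (U : C * C -> Prop) (w : one_form3) : Prop :=
  forall p z, U p -> wedge w (exterior_derivative w) (p, z) = 0.

Definition form3_eval (w : one_form3) (m v : C * C * C) : C :=
  let '(vx, vy, vz) := v in
  form3_dx w m * vx + form3_dy w m * vy + form3_dz w m * vz.

(* dz - alpha0 z^2 - beta0 z - gamma0 *)
Definition riccati_form (alpha0 beta0 gamma0 : one_form2) : one_form3 :=
  OneForm3
    (fun '(p, z) =>
       - (form_dx alpha0 p * z ^ 2 + form_dx beta0 p * z + form_dx gamma0 p))
    (fun '(p, z) =>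
       - (form_dy alpha0 p * z ^ 2 + form_dy beta0 p * z + form_dy gamma0 p))
    (fun _ => 1).

(* dy - z dx *)
Definition contact_form : one_form3 :=
  OneForm3 (fun '(_, z) => - z) (fun _ => 1) (fun _ => 0).

Definition geodesic_field (Pi : projective_structure) (m : C * C * C) : C * C * C :=
  let '(p, z) := m in (RtoC 1, z, second_order_rhs Pi p z).

(* At each point over U, ker w and ker (dy - z dx) intersect in the line
   spanned by the geodesic field. *)
Definition cuts_geodesic_foliation (U : C * C -> Prop)
    (w : one_form3) (Pi : projective_structure) : Prop :=
  forall p z, U p -> forall v : C * C * C,
    (form3_eval w (p, z) v = 0 /\ form3_eval contact_form (p, z) v = 0) <->
    exists c : C,
      let '(gx, gy, gz) := geodesic_field Pi (p, z) in
      v = (c * gx, c * gy, c * gz).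

Definition foliated_on (U : C * C -> Prop) (Pi : projective_structure) : Prop :=
  exists alpha0 beta0 gamma0 : one_form2,
    holomorphic_form_on U alpha0 /\
    holomorphic_form_on U beta0 /\
    holomorphic_form_on U gamma0 /\
    frobenius_integrable_over U (riccati_form alpha0 beta0 gamma0) /\
    cuts_geodesic_foliation U (riccati_form alpha0 beta0 gamma0) Pi.

(* Off Omega the coefficients below are junk values, since [/ 0] is total. *)
Definition Omega (p : C * C) : Prop :=
  let '(x, y) := p in x * y * (x - 1) * (y - 1) * (y - x) <> 0.

Definition painleve6 (alpha beta gamma delta : C) : projective_structure :=
  ProjectiveStructure
    (fun '(x, y) =>
       y * (y - 1) * (y - x) / (x ^ 2 * (x - 1) ^ 2) *
       (alpha + beta * x / y ^ 2 + gamma * (x - 1) / (y - 1) ^ 2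
        + delta * x * (x - 1) / (y - x) ^ 2))
    (fun '(x, y) => - (1 / x + 1 / (x - 1) + 1 / (y - x)))
    (fun '(x, y) => 1 / 2 * (1 / y + 1 / (y - 1) + 1 / (y - x)))
    (fun _ => 0).

Lemma painleve6_equation (alpha beta gamma delta x y y' : C) :
  second_order_rhs (painleve6 alpha beta gamma delta) (x, y) y' =
  1 / 2 * (1 / y + 1 / (y - 1) + 1 / (y - x)) * y' ^ 2
  - (1 / x + 1 / (x - 1) + 1 / (y - x)) * y'
  + y * (y - 1) * (y - x) / (x ^ 2 * (x - 1) ^ 2) *
    (alpha + beta * x / y ^ 2 + gamma * (x - 1) / (y - 1) ^ 2
     + delta * x * (x - 1) / (y - x) ^ 2).
Proof.
  unfold second_order_rhs; cbn [painleve6 coefA coefB coefC coefD].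
  unfold Cdiv; ring.
Qed.

Definition picard_parameter : C * C * C * C :=
  (RtoC 0, RtoC 0, RtoC 0, RtoC 1 / RtoC 2).

(* Main.v *)
(* For a Riccati form cutting the geodesic foliation, the coefficient D = 0 kills
   the dy-part of alpha0, and the form is determined by a (the dx-part of alpha0)
   and c (the dy-part of gamma0).  Frobenius integrability becomes
     a_y = a^2 - C a,   c_x = A_y + B c - c^2 - C A + a A,
     c_y = a_x + 2 a c + E,   with E = B_y - C_x.
   Put T = a_x + a c.  Equating mixed derivatives gives
     T_y = (3 a - C) T,   T_x = (B - 3 c) T + K,   6 T^2 = K_y + C K - 3 a K,
   where K = (V_y - C V)_y and V is the difference between A and its value at the
   Picard parameter; so K is rational in y, and zero only for that parameter.  On
   a line x = const, differentiating the last relation twice in y eliminates T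
   and yields two quadratic equations for a with coefficients rational in y,
   hence a itself is rational.  Then h = 1 / a is a rational solution of
   h' = P' / (2 P) h - 1 with P = y (y - 1) (y - x), i.e. an elliptic integral of
   the first kind would be rational; comparing the zeros of h at the roots of P
   with its degree excludes this.  The degenerate cases of the elimination are
   excluded by the leading coefficients of K at 0, 1, x and infinity. *)
Require Import Defs.
From Stdlib Require Import Reals Lra Lia Classical.
From Coquelicot Require Import Coquelicot.
From mathcomp Require all_boot all_order all_algebra ring zify complex Rstruct.
Open Scope C_scope.

(** Equating mixed derivatives takes more regularity than is given at the start: holomorphic means
    differentiable at each point, so neither the continuity nor the y-derivative of a_x is known.
    Both are extracted from the equations instead of from Cauchy theory. Since a_y = a^2 - C a is a
    Bernoulli equation and C = P' / (2 P), the function 1 / (a sqrt P) has an explicit y-derivative,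
    and T turns out to be P a^3 times a function of x alone. This works where a does not vanish; if
    a vanishes identically, so does T. Once x is fixed, K is written as k0 P^(-e) up to a constant
    factor, with k0 a polynomial in y. At a root r of P the numerators that enter the elimination
    then take values determined by P'(r) and k0(r), so nondegeneracy can be tested there. The
    exponent e = 3 forces beta = gamma = 0 and delta = 1/2. What remains of K is linear in y, is
    treated with e = 0, and forces alpha = 0. *)

(** * Neighbourhoods in C and in C^2 in terms of the modulus *)

Lemma locally_Cmod (z : C) (Q : C -> Prop) :
  locally z Q <-> exists d, (0 < d)%R /\ forall w, (Cmod (w - z) < d)%R -> Q w.
Proof.
split.
- intros [d Hd]; exists d; split; [apply cond_pos|].
  intros w Hw; apply Hd; apply (C_NormedModule_mixin_compat1 z w d Hw).
- intros [d [Hd H]].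
  (* Balls of C as a product space are squares, so the radius shrinks by sqrt 2. *)
  assert (H2 : (0 < d / sqrt 2)%R).
  { apply Rdiv_lt_0_compat; [exact Hd|]; apply Rlt_sqrt2_0. }
  exists (mkposreal _ H2); intros w Hw; apply H.
  pose proof (C_NormedModule_mixin_compat2 z w _ Hw) as K; simpl in K.
  replace (sqrt 2 * (d / sqrt 2))%R with d in K; [exact K|].
  field; apply Rgt_not_eq, Rlt_sqrt2_0.
Qed.

Lemma locally2_Cmod (p : C * C) (Q : C * C -> Prop) :
  locally p Q <-> exists d, (0 < d)%R /\ forall x y,
    (Cmod (x - fst p) < d)%R -> (Cmod (y - snd p) < d)%R -> Q (x, y).
Proof.
split.
- intros [d Hd]; exists d; split; [apply cond_pos|].
  intros x y Hx Hy; apply Hd; split.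
  + apply (C_NormedModule_mixin_compat1 (fst p) x d Hx).
  + apply (C_NormedModule_mixin_compat1 (snd p) y d Hy).
- intros [d [Hd H]].
  assert (H2 : (0 < d / sqrt 2)%R).
  { apply Rdiv_lt_0_compat; [exact Hd|]; apply Rlt_sqrt2_0. }
  assert (E : (sqrt 2 * (d / sqrt 2))%R = d) by (field; apply Rgt_not_eq, Rlt_sqrt2_0).
  exists (mkposreal _ H2); intros [x y] [Hx Hy]; apply H; rewrite <- E.
  + exact (C_NormedModule_mixin_compat2 (fst p) x (mkposreal _ H2) Hx).
  + exact (C_NormedModule_mixin_compat2 (snd p) y (mkposreal _ H2) Hy).
Qed.

Lemma locally_fst (p : C * C) (Q : C -> Prop) :
  locally (fst p) Q -> locally p (fun q => Q (fst q)).
Proof.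
rewrite locally_Cmod, locally2_Cmod; intros [d [Hd H]]; exists d; split; [exact Hd|].
intros x y Hx _; exact (H x Hx).
Qed.

Lemma locally_snd (p : C * C) (Q : C -> Prop) :
  locally (snd p) Q -> locally p (fun q => Q (snd q)).
Proof.
rewrite locally_Cmod, locally2_Cmod; intros [d [Hd H]]; exists d; split; [exact Hd|].
intros x y _ Hy; exact (H y Hy).
Qed.

Lemma locally_slice_x (x y : C) (Q : C * C -> Prop) :
  locally (x, y) Q -> locally x (fun t => Q (t, y)).
Proof.
rewrite locally_Cmod, locally2_Cmod; intros [d [Hd H]]; exists d; split; [exact Hd|].
intros w Hw; apply H; [exact Hw|]; simpl.
replace (y - y) with (RtoC 0) by ring; rewrite Cmod_0; exact Hd.
Qed.

Lemma locally_slice_y (x y : C) (Q : C * C -> Prop) :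
  locally (x, y) Q -> locally y (fun t => Q (x, t)).
Proof.
rewrite locally_Cmod, locally2_Cmod; intros [d [Hd H]]; exists d; split; [exact Hd|].
intros w Hw; apply H; [|exact Hw]; simpl.
replace (x - x) with (RtoC 0) by ring; rewrite Cmod_0; exact Hd.
Qed.

(** * Limits of complex functions along a filter *)

Definition tends {X : Type} (F : (X -> Prop) -> Prop) (f : X -> C) (l : C) : Prop :=
  forall eps : R, (0 < eps)%R -> F (fun x => (Cmod (f x - l) < eps)%R).

Section TendsArithmetic.
Context {X : Type} {F : (X -> Prop) -> Prop} {FF : Filter F}.

Lemma tends_ext (f g : X -> C) (l : C) :
  F (fun x => f x = g x) -> tends F f l -> tends F g l.
Proof.
intros E H eps He.
generalize (filter_and _ _ E (H eps He)); apply filter_imp; intros x [E1 H1]; rewrite <- E1; exact H1.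
Qed.

Lemma tends_const (c : C) : tends F (fun _ => c) c.
Proof.
intros eps He; apply filter_forall; intros x.
replace (c - c) with (RtoC 0) by ring; rewrite Cmod_0; exact He.
Qed.

Lemma tends_plus (f g : X -> C) (a b : C) :
  tends F f a -> tends F g b -> tends F (fun x => f x + g x) (a + b).
Proof.
intros Hf Hg eps He.
assert (H2 : (0 < eps / 2)%R) by lra.
generalize (filter_and _ _ (Hf _ H2) (Hg _ H2)); apply filter_imp; intros x [H1 H3].
replace (f x + g x - (a + b)) with ((f x - a) + (g x - b)) by ring.
eapply Rle_lt_trans; [apply Cmod_triangle|]; lra.
Qed.

Lemma tends_mult (f g : X -> C) (a b : C) :
  tends F f a -> tends F g b -> tends F (fun x => f x * g x) (a * b).
Proof.
intros Hf Hg eps He.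
pose proof (Cmod_ge_0 a) as Ha; pose proof (Cmod_ge_0 b) as Hb.
(* The cap 1 makes the product of the two errors at most [e]. *)
set (e := Rmin 1 (eps / (1 + Cmod a + Cmod b))).
assert (e0 : (0 < e)%R).
{ apply Rmin_pos; [lra|]; apply Rdiv_lt_0_compat; lra. }
generalize (filter_and _ _ (Hf _ e0) (Hg _ e0)); apply filter_imp; intros x [H1 H2].
replace (f x * g x - a * b) with ((f x - a) * (g x - b) + a * (g x - b) + (f x - a) * b) by ring.
pose proof (Cmod_ge_0 (f x - a)); pose proof (Cmod_ge_0 (g x - b)).
assert (E1 : (e <= 1)%R) by apply Rmin_l.
assert (E2 : (e * (1 + Cmod a + Cmod b) <= eps)%R).
{ apply Rle_trans with (eps / (1 + Cmod a + Cmod b) * (1 + Cmod a + Cmod b))%R.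
  - apply Rmult_le_compat_r; [lra|apply Rmin_r].
  - apply Req_le; field; lra. }
eapply Rle_lt_trans; [apply Cmod_triangle|].
eapply Rle_lt_trans; [apply Rplus_le_compat_r, Cmod_triangle|].
rewrite !Cmod_mult.
nra.
Qed.

Lemma tends_inv (f : X -> C) (a : C) :
  a <> 0 -> tends F f a -> tends F (fun x => / f x) (/ a).
Proof.
intros a0 Hf eps He.
assert (Ha : (0 < Cmod a)%R) by (apply Cmod_gt_0; exact a0).
(* The first bound keeps |f x| above |a| / 2; the second then controls |f x - a| / |f x a|. *)
set (e := Rmin (Cmod a / 2) (eps * Cmod a * Cmod a / 2)).
assert (e0 : (0 < e)%R).
{ apply Rmin_pos; [lra|]. apply Rmult_lt_0_compat; [|lra].
  repeat apply Rmult_lt_0_compat; assumption. }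
generalize (Hf _ e0); apply filter_imp; intros x H1.
assert (H2 : (Cmod a / 2 < Cmod (f x))%R).
{ assert (e <= Cmod a / 2)%R by apply Rmin_l.
  assert (Cmod a <= Cmod (f x) + Cmod (f x - a))%R.
  { replace a with (f x + - (f x - a)) at 1 by ring.
    eapply Rle_trans; [apply Cmod_triangle|]; rewrite Cmod_opp; apply Rle_refl. }
  lra. }
assert (fx0 : f x <> 0) by (apply Cmod_gt_0; lra).
replace (/ f x - / a) with (- (f x - a) / (f x * a)) by (field; split; assumption).
rewrite Cmod_div by (apply Cmult_neq_0; assumption).
rewrite Cmod_opp, Cmod_mult.
apply Rmult_lt_reg_r with (Cmod (f x) * Cmod a)%R; [nra|].
unfold Rdiv; rewrite Rmult_assoc, Rinv_l, Rmult_1_r by nra.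
assert (e <= eps * Cmod a * Cmod a / 2)%R by apply Rmin_r.
eapply Rlt_le_trans; [exact H1|]; eapply Rle_trans; [eassumption|].
assert (0 < eps * Cmod a)%R by (apply Rmult_lt_0_compat; assumption).
nra.
Qed.

Lemma tends_opp (f : X -> C) (a : C) : tends F f a -> tends F (fun x => - f x) (- a).
Proof.
intros Hf eps He; generalize (Hf _ He); apply filter_imp; intros x H.
replace (- f x - - a) with (- (f x - a)) by ring; rewrite Cmod_opp; exact H.
Qed.

Lemma tends_minus (f g : X -> C) (a b : C) :
  tends F f a -> tends F g b -> tends F (fun x => f x - g x) (a - b).
Proof. intros; apply tends_plus; [|apply tends_opp]; assumption. Qed.

Lemma tends_div (f g : X -> C) (a b : C) : b <> 0 ->
  tends F f a -> tends F g b -> tends F (fun x => f x / g x) (a / b).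
Proof. intros; apply tends_mult; [|apply tends_inv]; assumption. Qed.

Lemma tends_pow (f : X -> C) (a : C) (n : nat) :
  tends F f a -> tends F (fun x => f x ^ n) (a ^ n).
Proof.
intros H; induction n as [|n IH]; simpl; [apply tends_const|apply tends_mult; assumption].
Qed.
End TendsArithmetic.

Lemma tends_id (z : C) : tends (locally z) (fun w => w) z.
Proof.
intros eps He; apply locally_Cmod; exists eps; split; [exact He|]; intros w Hw; exact Hw.
Qed.

Lemma tends_fst (p : C * C) : tends (locally p) fst (fst p).
Proof. intros eps He; apply (locally_fst p (fun x => (Cmod (x - fst p) < eps)%R)), tends_id, He. Qed.

Lemma tends_snd (p : C * C) : tends (locally p) snd (snd p).
Proof. intros eps He; apply (locally_snd p (fun x => (Cmod (x - snd p) < eps)%R)), tends_id, He. Qed.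

(** * Complex derivatives in one variable *)

Definition der (f : C -> C) (z l : C) : Prop :=
  forall eps : R, (0 < eps)%R ->
    locally z (fun w => (Cmod (f w - f z - l * (w - z)) <= eps * Cmod (w - z))%R).

(* Caratheodory's form of differentiability, which turns the differentiation
   rules into algebra. *)
Lemma der_slope (f : C -> C) (z l : C) :
  der f z l <->
  exists g, tends (locally z) g l /\ locally z (fun w => f w - f z = g w * (w - z)).
Proof.
split.
- intros H.
  exists (fun w => if Ceq_dec w z then l else (f w - f z) / (w - z)); split.
  + intros eps He; assert (H2 : (0 < eps / 2)%R) by lra.
    generalize (H _ H2); apply filter_imp; intros w Hw.
    destruct (Ceq_dec w z) as [_|n].
    * replace (l - l) with (RtoC 0) by ring; rewrite Cmod_0; exact He.
    * assert (n0 : w - z <> 0).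
      { intros E; apply n; replace w with ((w - z) + z) by ring; rewrite E; ring. }
      apply Cmod_gt_0 in n0 as n1.
      replace ((f w - f z) / (w - z) - l) with ((f w - f z - l * (w - z)) / (w - z)) by (field; exact n0).
      rewrite Cmod_div by exact n0.
      apply Rmult_lt_reg_r with (Cmod (w - z)); [exact n1|].
      unfold Rdiv; rewrite Rmult_assoc, Rinv_l, Rmult_1_r by lra.
      nra.
  + apply filter_forall; intros w; destruct (Ceq_dec w z) as [->|n]; [ring|].
    field; intros E; apply n; replace w with ((w - z) + z) by ring; rewrite E; ring.
- intros [g [Hg E]] eps He.
  generalize (filter_and _ _ (Hg _ He) E); apply filter_imp; intros w [H1 H2].
  rewrite H2; replace (g w * (w - z) - l * (w - z)) with ((g w - l) * (w - z)) by ring.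
  rewrite Cmod_mult; apply Rmult_le_compat_r; [apply Cmod_ge_0|lra].
Qed.

Lemma der_tends (f : C -> C) (z l : C) : der f z l -> tends (locally z) f (f z).
Proof.
intros H; apply der_slope in H; destruct H as [g [Hg E]].
replace (f z) with (f z + l * (z - z)) by ring.
eapply tends_ext;
  [|apply tends_plus; [apply (tends_const (f z))|apply tends_mult;
     [exact Hg|apply tends_minus; [apply tends_id|apply tends_const]]]].
revert E; apply filter_imp; intros w E; simpl; rewrite <- E; ring.
Qed.

Lemma der_eq (f : C -> C) (z l l' : C) : der f z l -> l = l' -> der f z l'.
Proof. intros H <-; exact H. Qed.

Lemma der_ext_loc (f g : C -> C) (z l : C) :
  locally z (fun w => f w = g w) -> der f z l -> der g z l.
Proof.
intros E H eps He; pose proof (locally_singleton _ _ E) as E0; simpl in E0.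
generalize (filter_and _ _ E (H eps He)); apply filter_imp; intros w [E1 H1].
rewrite <- E0, <- E1; exact H1.
Qed.

Lemma der_const (c z : C) : der (fun _ => c) z 0.
Proof.
apply der_slope; exists (fun _ => RtoC 0); split; [apply tends_const|].
apply filter_forall; intros; ring.
Qed.

Lemma der_id (z : C) : der (fun w => w) z 1.
Proof.
apply der_slope; exists (fun _ => RtoC 1); split; [apply tends_const|].
apply filter_forall; intros; ring.
Qed.

Lemma der_plus (f g : C -> C) (z a b : C) :
  der f z a -> der g z b -> der (fun w => f w + g w) z (a + b).
Proof.
intros Hf Hg; apply der_slope in Hf, Hg; apply der_slope.
destruct Hf as [u [Hu Eu]], Hg as [v [Hv Ev]].
exists (fun w => u w + v w); split; [apply tends_plus; assumption|].
generalize (filter_and _ _ Eu Ev); apply filter_imp; intros w [E1 E2].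
replace (f w + g w - (f z + g z)) with ((f w - f z) + (g w - g z)) by ring.
rewrite E1, E2; ring.
Qed.

Lemma der_mult (f g : C -> C) (z a b : C) :
  der f z a -> der g z b -> der (fun w => f w * g w) z (a * g z + f z * b).
Proof.
intros Hf Hg; pose proof (der_tends _ _ _ Hg) as Tg.
apply der_slope in Hf, Hg; apply der_slope.
destruct Hf as [u [Hu Eu]], Hg as [v [Hv Ev]].
exists (fun w => u w * g w + f z * v w); split.
{ apply tends_plus; apply tends_mult; try assumption; apply tends_const. }
generalize (filter_and _ _ Eu Ev); apply filter_imp; intros w [E1 E2].
replace (f w * g w - f z * g z) with ((f w - f z) * g w + f z * (g w - g z)) by ring.
rewrite E1, E2; ring.
Qed.

Lemma tends_neq {X : Type} {F : (X -> Prop) -> Prop} {FF : Filter F} (f : X -> C) (a : C) :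
  a <> 0 -> tends F f a -> F (fun x => f x <> 0).
Proof.
intros a0 H; assert (Ha : (0 < Cmod a)%R) by (apply Cmod_gt_0; exact a0).
generalize (H _ Ha); apply filter_imp; intros x Hx E; rewrite E in Hx.
replace (0 - a) with (- a) in Hx by ring; rewrite Cmod_opp in Hx; lra.
Qed.

Lemma der_inv (f : C -> C) (z a : C) :
  f z <> 0 -> der f z a -> der (fun w => / f w) z (- a / f z ^ 2).
Proof.
intros f0 Hf; pose proof (der_tends _ _ _ Hf) as Tf.
apply der_slope in Hf; apply der_slope.
destruct Hf as [u [Hu Eu]].
exists (fun w => - u w / (f w * f z)); split.
{ replace (f z ^ 2) with (f z * f z) by ring.
  apply tends_div; [apply Cmult_neq_0; assumption|apply tends_opp; exact Hu|].
  apply tends_mult; [exact Tf|apply tends_const]. }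
generalize (filter_and _ _ Eu (tends_neq _ _ f0 Tf)); apply filter_imp; intros w [E1 E2].
replace (/ f w - / f z) with (- (f w - f z) / (f w * f z)) by (field; split; assumption).
rewrite E1; field; split; assumption.
Qed.

Lemma der_opp (f : C -> C) (z a : C) : der f z a -> der (fun w => - f w) z (- a).
Proof.
intros H; eapply der_eq; [eapply der_ext_loc; [|apply (der_mult _ _ _ _ _ (der_const (-(1)) z) H)]|].
- apply filter_forall; intros w; simpl; ring.
- simpl; ring.
Qed.

Lemma der_minus (f g : C -> C) (z a b : C) :
  der f z a -> der g z b -> der (fun w => f w - g w) z (a - b).
Proof. intros; apply der_plus; [|apply der_opp]; assumption. Qed.

Lemma der_div (f g : C -> C) (z a b : C) : g z <> 0 ->
  der f z a -> der g z b -> der (fun w => f w / g w) z (a * / g z + f z * (- b / g z ^ 2)).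
Proof. intros g0 Hf Hg; exact (der_mult _ _ _ _ _ Hf (der_inv _ _ _ g0 Hg)). Qed.

Lemma der_pow (f : C -> C) (z a : C) (n : nat) :
  der f z a -> der (fun w => f w ^ S n) z (INR (S n) * a * f z ^ n).
Proof.
intros H; induction n as [|n IH].
- eapply der_eq; [eapply der_ext_loc; [|exact H]|]; [apply filter_forall; intros; simpl; ring|].
  simpl; ring.
- eapply der_eq; [apply (der_mult _ _ _ _ _ H IH)|].
  rewrite (S_INR (S n)), RtoC_plus; simpl; ring.
Qed.

Lemma der_unique (f : C -> C) (z a b : C) : der f z a -> der f z b -> a = b.
Proof.
intros Ha Hb; destruct (Ceq_dec a b) as [E|n]; [exact E|exfalso].
assert (n0 : a - b <> 0).
{ intros E; apply n; replace a with ((a - b) + b) by ring; rewrite E; ring. }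
apply Cmod_gt_0 in n0.
assert (e : (0 < Cmod (a - b) / 4)%R) by lra.
generalize (filter_and _ _ (Ha _ e) (Hb _ e)); rewrite locally_Cmod; intros [d [Hd H]].
assert (Ez : z + RtoC (d / 2) - z = RtoC (d / 2)) by ring.
destruct (H (z + RtoC (d / 2))) as [H1 H2].
{ rewrite Ez, Cmod_R, Rabs_pos_eq; lra. }
rewrite Ez in H1, H2; rewrite Cmod_R, Rabs_pos_eq in H1, H2 by lra.
assert (K : (Cmod ((a - b) * RtoC (d / 2)) <= 2 * (Cmod (a - b) / 4 * (d / 2)))%R).
{ set (u := f (z + RtoC (d / 2)) - f z) in *.
  replace ((a - b) * RtoC (d / 2)) with ((u - b * RtoC (d / 2)) + - (u - a * RtoC (d / 2))) by ring.
  eapply Rle_trans; [apply Cmod_triangle|]; rewrite Cmod_opp; lra. }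
rewrite Cmod_mult, Cmod_R, Rabs_pos_eq in K by lra.
nra.
Qed.

(** * Mean value inequality and mixed partial derivatives *)

Lemma der_segment_Re (F : C -> C) (a v l : C) (t : R) :
  der F (a + t * v) l -> is_derive (fun s : R => Re (F (a + s * v))) t (Re (l * v)).
Proof.
intros H; apply is_derive_Reals; intros eps He.
pose proof (Cmod_ge_0 v) as Hv.
assert (e0 : (0 < eps / (2 * (Cmod v + 1)))%R) by (apply Rdiv_lt_0_compat; lra).
generalize (H _ e0); rewrite locally_Cmod; intros [d [Hd K]].
assert (d0 : (0 < d / (Cmod v + 1))%R) by (apply Rdiv_lt_0_compat; lra).
exists (mkposreal _ d0); intros h h0 Hh; simpl in Hh.
assert (Ew : a + RtoC (t + h) * v - (a + t * v) = RtoC h * v) by (rewrite RtoC_plus; ring).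
assert (Ah : (0 < Rabs h)%R) by (apply Rabs_pos_lt; exact h0).
assert (Hd' : (Rabs h * (Cmod v + 1) < d)%R).
{ apply Rmult_lt_reg_r with (/ (Cmod v + 1))%R; [apply Rinv_0_lt_compat; lra|].
  rewrite Rmult_assoc, Rinv_r, Rmult_1_r by lra; exact Hh. }
specialize (K (a + RtoC (t + h) * v)).
rewrite Ew, Cmod_mult, Cmod_R in K.
assert (K1 : (Rabs h * Cmod v < d)%R) by nra.
specialize (K K1).
set (u := F (a + RtoC (t + h) * v) - F (a + t * v) - l * (RtoC h * v)) in K.
replace ((Re (F (a + RtoC (t + h) * v)%C) - Re (F (a + t * v)%C)) / h - Re (l * v)%C)%R
  with (Re u / h)%R.
2: { unfold u, Re; simpl; field; exact h0. }
unfold Rdiv; rewrite Rabs_mult, Rabs_inv.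
apply Rmult_lt_reg_r with (Rabs h); [exact Ah|].
rewrite Rmult_assoc, Rinv_l, Rmult_1_r by lra.
eapply Rle_lt_trans; [apply re_le_Cmod|].
eapply Rle_lt_trans; [exact K|].
assert (E2 : (eps / (2 * (Cmod v + 1)) * (Cmod v + 1) = eps / 2)%R) by (field; lra).
assert (0 < eps * Rabs h)%R by (apply Rmult_lt_0_compat; assumption).
assert (eps / (2 * (Cmod v + 1)) * Cmod v <= eps / 2)%R by nra.
nra.
Qed.

(** The real mean value bound is applied on the segment to Re (conj D f) with D = f b - f a. Its
    increment is |D|^2 and its derivative is at most |D| M |b - a|; dividing by |D| gives the
    claim. *)
Lemma mean_value_inequality (f f' : C -> C) (a b : C) (M : R) :
  (forall w, (Cmod (w - a) <= Cmod (b - a))%R -> der f w (f' w) /\ (Cmod (f' w) <= M)%R) ->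
  (Cmod (f b - f a) <= M * Cmod (b - a))%R.
Proof.
intros H; set (D := f b - f a); set (v := b - a).
pose proof (Cmod_ge_0 D) as HD.
assert (K : forall t : R, (Rabs (t - 0) <= Rabs (1 - 0))%R ->
  is_derive (fun s : R => Re (Cconj D * f (a + s * v))) t
    (Re (Cconj D * f' (a + t * v) * v)) /\
  (Rabs (Re (Cconj D * f' (a + t * v) * v)%C) <= Cmod D * M * Cmod v)%R).
{ intros t Ht; rewrite Rminus_0_r, Rminus_0_r, Rabs_R1 in Ht.
  destruct (H (a + t * v)) as [H1 H2].
  { replace (a + t * v - a) with (t * v) by ring; rewrite Cmod_mult, Cmod_R.
    pose proof (Cmod_ge_0 v); fold v; nra. }
  split.
  - apply (der_segment_Re (fun w => Cconj D * f w)).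
    eapply der_eq; [apply der_mult; [apply der_const|exact H1]|]; cbv beta; ring.
  - eapply Rle_trans; [apply re_le_Cmod|].
    rewrite !Cmod_mult, Cmod_conj.
    apply Rmult_le_compat_r; [apply Cmod_ge_0|]; apply Rmult_le_compat_l; assumption. }
pose proof (bounded_variation _ _ _ 0 1 K) as B; cbv beta in B.
replace (a + 1%R * v) with b in B by (unfold v; ring).
replace (a + 0%R * v) with a in B by (unfold v; ring).
replace (Re (Cconj D * f b)%C - Re (Cconj D * f a)%C)%R with (Cmod D ^ 2)%R in B.
2: { rewrite Cmod2_alt; unfold D, Re, Im; simpl; ring. }
rewrite Rminus_0_r, Rabs_R1, Rmult_1_r, Rabs_pos_eq in B by apply pow2_ge_0.
destruct (Req_dec (Cmod D) 0) as [E|n].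
- rewrite E in *; destruct (H a) as [_ H0].
  { replace (a - a) with (RtoC 0) by ring; rewrite Cmod_0; apply Cmod_ge_0. }
  apply Rmult_le_pos; [|apply Cmod_ge_0]; eapply Rle_trans; [apply Cmod_ge_0|exact H0].
- apply Rmult_le_reg_l with (Cmod D); [lra|]; simpl in B; lra.
Qed.

Definition dx (f : C * C -> C) (p : C * C) (l : C) : Prop :=
  der (fun t => f (t, snd p)) (fst p) l.
Definition dy (f : C * C -> C) (p : C * C) (l : C) : Prop :=
  der (fun t => f (fst p, t)) (snd p) l.

(* Peano's form of Schwarz's theorem: only one mixed derivative is assumed to
   exist, so that the regularity theory of holomorphic functions is not needed. *)
Lemma mixed_derivative (f g k m : C * C -> C) (p : C * C) :
  locally p (fun q => dx f q (g q)) -> locally p (fun q => dy f q (k q)) ->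
  locally p (fun q => dy g q (m q)) -> tends (locally p) m (m p) ->
  dx k p (m p).
Proof.
destruct p as [x0 y0]; intros Hf Hk Hg Hm eps He; simpl fst; simpl snd.
generalize (filter_and _ _ Hf (filter_and _ _ Hk (filter_and _ _ Hg (Hm _ He)))).
rewrite locally2_Cmod; simpl fst; simpl snd; intros [d [Hd K]].
apply locally_Cmod; exists d; split; [exact Hd|]; intros x1 Hx1.
assert (Zy : (Cmod (y0 - y0) < d)%R).
{ replace (y0 - y0) with (RtoC 0) by ring; rewrite Cmod_0; exact Hd. }
assert (Zx : (Cmod (x0 - x0) < d)%R).
{ replace (x0 - x0) with (RtoC 0) by ring; rewrite Cmod_0; exact Hd. }
set (l := m (x0, y0)) in *.
(* the double difference is controlled by the mean value inequality, first in y, then in x *)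
assert (B : forall y, (Cmod (y - y0) < d)%R ->
  (Cmod ((f (x1, y) - f (x1, y0) - l * x1 * (y - y0))
        - (f (x0, y) - f (x0, y0) - l * x0 * (y - y0))) <= eps * Cmod (y - y0) * Cmod (x1 - x0))%R).
{ intros y Hy.
  apply (mean_value_inequality (fun x => f (x, y) - f (x, y0) - l * x * (y - y0))
           (fun x => (g (x, y) - l * y) - (g (x, y0) - l * y0))).
  intros x Hx; assert (Hx' : (Cmod (x - x0) < d)%R) by lra; split.
  - destruct (K x y Hx' Hy) as [F1 _]; destruct (K x y0 Hx' Zy) as [F2 _].
    unfold dx in F1, F2; simpl in F1, F2.
    eapply der_eq; [apply der_minus; [apply der_minus; [exact F1|exact F2]|]|].
    + apply (der_mult (fun t => l * t) (fun _ => y - y0)); [|apply der_const].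
      apply der_mult; [apply der_const|apply der_id].
    + cbv beta; ring.
  - apply (mean_value_inequality (fun t => g (x, t) - l * t) (fun t => m (x, t) - l)).
    intros w Hw; assert (Hw' : (Cmod (w - y0) < d)%R) by lra.
    destruct (K x w Hx' Hw') as [_ [_ [G M]]]; unfold dy in G; simpl in G; split; [|lra].
    eapply der_eq; [apply der_minus; [exact G|apply der_mult; [apply der_const|apply der_id]]|]; cbv beta; ring. }
(* [k] is a limit of vertical difference quotients of [f], so a violation by [gap] would survive at
   a small step [h] and contradict [B]. *)
apply Rnot_lt_le; intros N.
set (gap := (Cmod (k (x1, y0) - k (x0, y0) - l * (x1 - x0))%C - eps * Cmod (x1 - x0)%C)%R).
assert (gap0 : (0 < gap / 4)%R) by (unfold gap; lra).
destruct (K x1 y0 Hx1 Zy) as [_ [K1 _]]; destruct (K x0 y0 Zx Zy) as [_ [K0 _]].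
unfold dy in K1, K0; simpl in K1, K0.
generalize (filter_and _ _ (K1 _ gap0) (K0 _ gap0)); rewrite locally_Cmod; intros [e [He' L]].
set (h := (Rmin d e / 2)%R).
assert (h0 : (0 < h)%R) by (unfold h; assert (0 < Rmin d e)%R by (apply Rmin_pos; assumption); lra).
assert (hd : (h < d)%R) by (unfold h; pose proof (Rmin_l d e); lra).
assert (he : (h < e)%R) by (unfold h; pose proof (Rmin_r d e); lra).
assert (Eh : Cmod (y0 + RtoC h - y0) = h).
{ replace (y0 + RtoC h - y0) with (RtoC h) by ring; rewrite Cmod_R, Rabs_pos_eq; lra. }
destruct (L (y0 + RtoC h)) as [L1 L0]; [rewrite Eh; exact he|].
specialize (B (y0 + RtoC h)); rewrite Eh in *; specialize (B hd).
replace (y0 + RtoC h - y0) with (RtoC h) in * by ring.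
set (u1 := f (x1, y0 + RtoC h)) in *; set (u0 := f (x0, y0 + RtoC h)) in *.
assert (T : (Cmod ((k (x1, y0) - k (x0, y0) - l * (x1 - x0)) * RtoC h) <=
   eps * h * Cmod (x1 - x0) + gap / 4 * h + gap / 4 * h)%R).
{ replace ((k (x1, y0) - k (x0, y0) - l * (x1 - x0)) * RtoC h) with
   ((u1 - f (x1, y0) - l * x1 * RtoC h - (u0 - f (x0, y0) - l * x0 * RtoC h))
    + - (u1 - f (x1, y0) - k (x1, y0) * RtoC h) + (u0 - f (x0, y0) - k (x0, y0) * RtoC h)) by ring.
  eapply Rle_trans; [apply Cmod_triangle|]; apply Rplus_le_compat; [|exact L0].
  eapply Rle_trans; [apply Cmod_triangle|]; apply Rplus_le_compat; [exact B|].
  rewrite Cmod_opp; exact L1. }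
rewrite Cmod_mult, Cmod_R, (Rabs_pos_eq h) in T by lra.
assert (E3 : (Cmod (k (x1, y0) - k (x0, y0) - l * (x1 - x0))%C = gap + eps * Cmod (x1 - x0)%C)%R)
  by (unfold gap; ring).
rewrite E3 in T; nra.
Qed.

Definition swap (f : C * C -> C) : C * C -> C := fun q => f (snd q, fst q).

Lemma locally_swap (p : C * C) (Q : C * C -> Prop) :
  locally p Q -> locally (snd p, fst p) (fun q => Q (snd q, fst q)).
Proof.
rewrite !locally2_Cmod; intros [d [Hd H]]; exists d; split; [exact Hd|]; simpl.
intros x y Hx Hy; apply H; assumption.
Qed.

Lemma mixed_derivative' (f g k m : C * C -> C) (p : C * C) :
  locally p (fun q => dy f q (g q)) -> locally p (fun q => dx f q (k q)) ->
  locally p (fun q => dx g q (m q)) -> tends (locally p) m (m p) ->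
  dy k p (m p).
Proof.
destruct p as [x y]; intros Hf Hk Hg Hm.
apply (mixed_derivative (swap f) (swap g) (swap k) (swap m) (y, x)).
- apply (locally_swap (x, y)) in Hf; exact Hf.
- apply (locally_swap (x, y)) in Hk; exact Hk.
- apply (locally_swap (x, y)) in Hg; exact Hg.
- intros eps He; specialize (Hm eps He); apply (locally_swap (x, y)) in Hm; exact Hm.
Qed.

(** * Link with [C_derive], and tactics for derivatives and limits *)

Lemma der_is_derive (f : C -> C) (z l : C) :
  der f z l -> is_derive (K := C_AbsRing) (V := C_NormedModule) f z l.
Proof.
intros H; split; [apply is_linear_scal_l|].
intros z' Hz; assert (E : z' = z).
{ symmetry; apply (is_filter_lim_locally_unique (K := C_AbsRing) (V := AbsRing_NormedModule C_AbsRing)); exact Hz. }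
subst z'.
intros eps; apply locally_C.
generalize (H eps (cond_pos eps)); apply filter_imp; intros w Hw.
change (Cmod ((f w - f z) - (w - z) * l) <= eps * Cmod (w - z))%R.
replace (f w - f z - (w - z) * l) with (f w - f z - l * (w - z)) by ring; exact Hw.
Qed.

Lemma C_derive_der (f : C -> C) (z l : C) : der f z l -> C_derive f z = l.
Proof. intros H; apply is_C_derive_unique, der_is_derive, H. Qed.

Ltac derive_step :=
  lazymatch goal with
  | |- der (fun _ => ?c) _ _ => apply der_const
  | |- der (fun w => w) _ _ => apply der_id
  | |- der (fun w => @?f w + @?g w) _ _ => eapply (der_plus f g)
  | |- der (fun w => @?f w - @?g w) _ _ => eapply (der_minus f g)
  | |- der (fun w => - @?f w) _ _ => eapply (der_opp f)
  | |- der (fun w => @?f w / @?g w) _ _ => eapply (der_div f g)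
  | |- der (fun w => @?f w * @?g w) _ _ => eapply (der_mult f g)
  | |- der (fun w => @?f w ^ S ?n) _ _ => eapply (der_pow f _ _ n)
  | |- der (fun w => / @?f w) _ _ => eapply (der_inv f)
  | |- der _ _ _ => eassumption
  end.
Ltac derive := eapply der_eq; [repeat derive_step|cbv beta; cbn [INR]; rewrite ?RtoC_plus;
  change (UniformSpace.sort C_UniformSpace) with C].

Ltac tends_step :=
  lazymatch goal with
  | |- tends _ (fun _ => ?c) _ => apply tends_const
  | |- tends _ (fun w => fst w) _ => apply tends_fst
  | |- tends _ (fun w => snd w) _ => apply tends_snd
  | |- tends _ (fun w => @?f w + @?g w) _ => apply (tends_plus f g)
  | |- tends _ (fun w => @?f w - @?g w) _ => apply (tends_minus f g)
  | |- tends _ (fun w => - @?f w) _ => apply (tends_opp f)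
  | |- tends _ (fun w => @?f w / @?g w) _ => apply (tends_div f g)
  | |- tends _ (fun w => @?f w * @?g w) _ => apply (tends_mult f g)
  | |- tends _ (fun w => @?f w ^ ?n) _ => apply (tends_pow f)
  | |- tends _ (fun w => / @?f w) _ => apply (tends_inv f)
  | |- tends _ _ _ => eassumption
  end.

(** * Coefficients of Painleve VI and their derivatives *)

Lemma Omega_neq (x y : C) : Omega (x, y) ->
  x <> 0 /\ y <> 0 /\ x - 1 <> 0 /\ y - 1 <> 0 /\ y - x <> 0.
Proof.
intros H; unfold Omega in H; repeat split; intros E; apply H; rewrite E; ring.
Qed.

Lemma RtoC_neq (a b : R) : a <> b -> RtoC a <> RtoC b.
Proof. intros H E; apply H, RtoC_inj, E. Qed.

Ltac nonzero :=
  repeat first [assumption | split | apply Cmult_neq_0 | apply Cpow_nz | (apply RtoC_neq; lra)].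

Section Coefficients.
Variables al be ga de : C.

Definition cubicP (x y : C) : C := y * (y - 1) * (y - x).
Definition cubicP1 (x y : C) : C := 3 * y ^ 2 - 2 * (1 + x) * y + x.
Definition cubicP2 (x y : C) : C := 6 * y - 2 * (1 + x).

Definition p6A (x y : C) : C :=
  y * (y - 1) * (y - x) / (x ^ 2 * (x - 1) ^ 2) *
       (al + be * x / y ^ 2 + ga * (x - 1) / (y - 1) ^ 2
        + de * x * (x - 1) / (y - x) ^ 2).
Definition p6B (x y : C) : C := - (1 / x + 1 / (x - 1) + 1 / (y - x)).
Definition p6C (x y : C) : C := 1 / 2 * (1 / y + 1 / (y - 1) + 1 / (y - x)).
Definition p6E (x y : C) : C := 1 / (2 * (y - x) ^ 2).

Definition p6R (x y : C) : C :=
  al + be * x / y ^ 2 + ga * (x - 1) / (y - 1) ^ 2 + (de - 1 / 2) * x * (x - 1) / (y - x) ^ 2.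
Definition p6R1 (x y : C) : C :=
  - 2 * (be * x / y ^ 3 + ga * (x - 1) / (y - 1) ^ 3 + (de - 1 / 2) * x * (x - 1) / (y - x) ^ 3).
Definition p6R2 (x y : C) : C :=
  6 * (be * x / y ^ 4 + ga * (x - 1) / (y - 1) ^ 4 + (de - 1 / 2) * x * (x - 1) / (y - x) ^ 4).
Definition p6R3 (x y : C) : C :=
  - 24 * (be * x / y ^ 5 + ga * (x - 1) / (y - 1) ^ 5 + (de - 1 / 2) * x * (x - 1) / (y - x) ^ 5).

(* [p6W] is [A_y - C A], and [p6K] is [(V_y - C V)_y] for the deviation
   [V = cubicP * p6R / (x^2 (x - 1)^2)] of [A] from the Picard parameter. *)
Definition p6W (x y : C) : C :=
  (1 / 2 * cubicP1 x y * p6R x y + cubicP x y * p6R1 x y) / (x ^ 2 * (x - 1) ^ 2)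
  + 1 / (4 * x * (x - 1)) * ((2 * y - 1) / (y - x) - 3 * y * (y - 1) / (y - x) ^ 2).
Definition p6K (x y : C) : C :=
  (1 / 2 * cubicP2 x y * p6R x y + 3 / 2 * cubicP1 x y * p6R1 x y + cubicP x y * p6R2 x y)
  / (x ^ 2 * (x - 1) ^ 2).
Definition p6K1 (x y : C) : C :=
  (3 * p6R x y + 2 * cubicP2 x y * p6R1 x y + 5 / 2 * cubicP1 x y * p6R2 x y + cubicP x y * p6R3 x y)
  / (x ^ 2 * (x - 1) ^ 2).

Variables x y : C.
Hypothesis Oxy : Omega (x, y).

Ltac prepare := destruct (Omega_neq _ _ Oxy) as (x_0 & y_0 & x_1 & y_1 & xy_0).

Lemma der_p6R : der (fun t => p6R x t) y (p6R1 x y).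
Proof. prepare; unfold p6R, p6R1; derive; nonzero; field; nonzero. Qed.

Lemma der_p6R1 : der (fun t => p6R1 x t) y (p6R2 x y).
Proof. prepare; unfold p6R1, p6R2; derive; nonzero; field; nonzero. Qed.

Lemma der_p6R2 : der (fun t => p6R2 x t) y (p6R3 x y).
Proof. prepare; unfold p6R2, p6R3; derive; nonzero; field; nonzero. Qed.

Lemma der_cubicP : der (fun t => cubicP x t) y (cubicP1 x y).
Proof. unfold cubicP, cubicP1; derive; ring. Qed.

Lemma der_cubicP1 : der (fun t => cubicP1 x t) y (cubicP2 x y).
Proof. unfold cubicP1, cubicP2; derive; ring. Qed.

Lemma der_cubicP2 : der (fun t => cubicP2 x t) y 6.
Proof. unfold cubicP2; derive; ring. Qed.

Lemma der_cubicP_x : der (fun t => cubicP t y) x (- y * (y - 1)).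
Proof. unfold cubicP; derive; ring. Qed.

Lemma der_p6C_x : der (fun t => p6C t y) x (p6E x y).
Proof. prepare; unfold p6C, p6E; derive; nonzero; field; nonzero. Qed.

(** [p6C] is half the logarithmic y-derivative of the cubic; this is what brings in the square root
    of the cubic later. *)
Lemma cubicP1_eq : cubicP1 x y = 2 * p6C x y * cubicP x y.
Proof. prepare; unfold p6C, cubicP1, cubicP; field; nonzero. Qed.

Lemma der_p6B : der (fun t => p6B x t) y (2 * p6E x y).
Proof. prepare; unfold p6B, p6E; derive; nonzero; field; nonzero. Qed.

Lemma der_p6E_x : der (fun t => p6E t y) x (1 / (y - x) ^ 3).
Proof. prepare; unfold p6E; derive; nonzero; field; nonzero. Qed.

Lemma der_p6A : der (fun t => p6A x t) y (p6W x y + p6C x y * p6A x y).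
Proof.
prepare; unfold p6W, p6A, p6C, p6R, p6R1, cubicP1, cubicP; derive; nonzero.
field; nonzero.
Qed.

(** The terms beside [p6K] come from the Picard part of [A]. The last one is the x-derivative of
    [p6E], so that only [p6K] survives when the mixed derivatives of [c] are compared. *)
Lemma der_p6W : der (fun t => p6W x t) y (p6K x y - p6B x y * p6E x y + 1 / (y - x) ^ 3).
Proof.
prepare; pose proof der_p6R; pose proof der_p6R1; pose proof der_cubicP; pose proof der_cubicP1.
unfold p6W, p6K, p6B, p6E; derive; nonzero.
generalize (p6R x y) (p6R1 x y) (p6R2 x y); intros; unfold cubicP2, cubicP1, cubicP.
field; nonzero.
Qed.

Lemma der_p6K : der (fun t => p6K x t) y (p6K1 x y).
Proof.
prepare; pose proof der_p6R; pose proof der_p6R1; pose proof der_p6R2; pose proof der_cubicP;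
  pose proof der_cubicP1; pose proof der_cubicP2.
unfold p6K, p6K1; derive; nonzero.
field; nonzero.
Qed.

End Coefficients.

(** * Principal square root on the right half plane *)

Definition csqrt (w : C) : C :=
  let u := sqrt ((Cmod w + Re w) / 2) in (u, (Im w / (2 * u))%R).

Lemma csqrt_Re_gt0 (w : C) : (0 < Re w)%R -> (0 < Re (csqrt w))%R.
Proof.
intros H; unfold csqrt; simpl; apply sqrt_lt_R0; pose proof (Cmod_ge_0 w); lra.
Qed.

Lemma csqrt_sqr (w : C) : (0 < Re w)%R -> csqrt w * csqrt w = w.
Proof.
intros H; pose proof (csqrt_Re_gt0 _ H) as K; unfold csqrt in *; simpl in K.
set (u := sqrt ((Cmod w + Re w) / 2)) in *.
assert (E : (u * u = (Cmod w + Re w) / 2)%R).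
{ apply sqrt_sqrt; pose proof (Cmod_ge_0 w); lra. }
pose proof (Cmod2_alt w) as E2.
destruct w as [r i]; unfold Re, Im in *; simpl fst in *; simpl snd in *.
set (N := Cmod (r, i)) in *.
unfold Cmult; simpl; f_equal.
- apply Rmult_eq_reg_l with (4 * (u * u))%R; [|nra].
  replace (4 * (u * u) * (u * u - i / (2 * u) * (i / (2 * u))))%R
    with (4 * (u * u) * (u * u) - i * i)%R by (field; lra).
  rewrite E; nra.
- field; lra.
Qed.

(** On the right half plane a sum of two roots has positive real part, hence is nonzero. Dividing by
    it turns this identity into continuity and differentiability of the root. *)
Lemma csqrt_sub (v w : C) : (0 < Re v)%R -> (0 < Re w)%R ->
  (csqrt v - csqrt w) * (csqrt v + csqrt w) = v - w.
Proof.
intros Hv Hw.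
replace v with (csqrt v * csqrt v) at 3 by (apply csqrt_sqr, Hv).
replace w with (csqrt w * csqrt w) at 3 by (apply csqrt_sqr, Hw).
ring.
Qed.

Lemma Re_gt0_neq (w : C) : (0 < Re w)%R -> w <> 0.
Proof. intros H E; rewrite E in H; simpl in H; lra. Qed.

Lemma csqrt_neq (w : C) : (0 < Re w)%R -> csqrt w <> 0.
Proof. intros H; apply Re_gt0_neq, csqrt_Re_gt0, H. Qed.

Lemma tends_Re_gt0 {X : Type} {F : (X -> Prop) -> Prop} {FF : Filter F} (f : X -> C) (l : C) :
  (0 < Re l)%R -> tends F f l -> F (fun x => (0 < Re (f x))%R).
Proof.
intros Hl H; generalize (H _ Hl); apply filter_imp; intros x Hx.
pose proof (re_le_Cmod (f x - l)) as K.
assert (E : (Re (f x - l)%C = Re (f x) - Re l)%R) by (unfold Re; simpl; ring).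
rewrite E in K; apply Rabs_le_between in K; lra.
Qed.

Lemma tends_csqrt {X : Type} {F : (X -> Prop) -> Prop} {FF : Filter F} (f : X -> C) (l : C) :
  (0 < Re l)%R -> tends F f l -> tends F (fun x => csqrt (f x)) (csqrt l).
Proof.
intros Hl H eps He; pose proof (csqrt_Re_gt0 _ Hl) as K.
assert (e0 : (0 < eps * Re (csqrt l))%R) by (apply Rmult_lt_0_compat; assumption).
generalize (filter_and _ _ (tends_Re_gt0 _ _ Hl H) (H _ e0)); apply filter_imp; intros x [H1 H2].
rewrite <- (csqrt_sub _ _ H1 Hl), Cmod_mult in H2.
pose proof (csqrt_Re_gt0 _ H1) as K1.
assert (K2 : (Re (csqrt l) <= Cmod (csqrt (f x) + csqrt l))%R).
{ eapply Rle_trans; [|apply re_le_Cmod].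
  replace (Re (csqrt (f x) + csqrt l)%C) with (Re (csqrt (f x)) + Re (csqrt l))%R by (unfold Re; simpl; ring).
  rewrite Rabs_pos_eq; lra. }
pose proof (Cmod_ge_0 (csqrt (f x) - csqrt l)); nra.
Qed.

Lemma der_csqrt (f : C -> C) (z l : C) :
  (0 < Re (f z))%R -> der f z l -> der (fun w => csqrt (f w)) z (l / (2 * csqrt (f z))).
Proof.
intros Hz H; pose proof (der_tends _ _ _ H) as T.
pose proof (tends_csqrt _ _ Hz T) as T2.
assert (N2 : 2 * csqrt (f z) <> 0) by (apply Cmult_neq_0; [apply RtoC_neq; lra|apply csqrt_neq, Hz]).
apply der_slope in H; apply der_slope; destruct H as [g [Hg E]].
exists (fun w => g w / (csqrt (f w) + csqrt (f z))); split.
- apply tends_div; [exact N2|exact Hg|].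
  replace (2 * csqrt (f z)) with (csqrt (f z) + csqrt (f z)) by ring.
  apply tends_plus; [exact T2|apply tends_const].
- generalize (filter_and _ _ E (tends_Re_gt0 _ _ Hz T)); apply filter_imp; intros w [E1 Hw].
  assert (N : csqrt (f w) + csqrt (f z) <> 0).
  { apply Re_gt0_neq; replace (Re (csqrt (f w) + csqrt (f z))%C)
      with (Re (csqrt (f w)) + Re (csqrt (f z)))%R by (unfold Re; simpl; ring).
    pose proof (csqrt_Re_gt0 _ Hw); pose proof (csqrt_Re_gt0 _ Hz); lra. }
  pose proof (csqrt_sub _ _ Hw Hz) as E2; rewrite E1 in E2.
  replace (csqrt (f w) - csqrt (f z)) with (g w * (w - z) / (csqrt (f w) + csqrt (f z))).
  + field; exact N.
  + rewrite <- E2; field; exact N.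
Qed.

(** * Regularity of [T] at points where [a] does not vanish *)

Lemma tends_slice_x (f : C * C -> C) (x y l : C) :
  tends (locally (x, y)) f l -> tends (locally x) (fun t => f (t, y)) l.
Proof. intros H eps He; exact (locally_slice_x _ _ _ (H eps He)). Qed.

Lemma disc_center (z : C) (d : R) : (0 < d)%R -> (Cmod (z - z) < d)%R.
Proof. intros H; replace (z - z) with (RtoC 0) by ring; rewrite Cmod_0; exact H. Qed.

(* The Riccati equation is [dz = (a dx) z^2 + ((B - c) dx + (Cc - a) dy) z + (A dx + c dy)],
   and [s] stands for the x-derivative of [a]. *)
Section Foliation.
Variables al be ga de : C.
Variable U : C * C -> Prop.
Variables a c s : C * C -> C.
Hypothesis U_open : open U.
Hypothesis U_Omega : forall p, U p -> Omega p.

Let A (q : C * C) : C := p6A al be ga de (fst q) (snd q).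
Let B (q : C * C) : C := p6B (fst q) (snd q).
Let Cc (q : C * C) : C := p6C (fst q) (snd q).
Let E (q : C * C) : C := p6E (fst q) (snd q).
Let W (q : C * C) : C := p6W al be ga de (fst q) (snd q).
Let K (q : C * C) : C := p6K al be ga de (fst q) (snd q).
Let K1 (q : C * C) : C := p6K1 al be ga de (fst q) (snd q).

Hypothesis a_y : forall p, U p -> dy a p (a p ^ 2 - Cc p * a p).
Hypothesis a_x : forall p, U p -> dx a p (s p).
Hypothesis c_x : forall p, U p -> dx c p (W p + B p * c p - c p ^ 2 + a p * A p).
Hypothesis c_y : forall p, U p -> dy c p (s p + 2 * a p * c p + E p).
Hypothesis a_cont : forall p, U p -> tends (locally p) a (a p).
Hypothesis c_cont : forall p, U p -> tends (locally p) c (c p).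

Let T (q : C * C) : C := s q + a q * c q.

(* With [phi] a square root of [cubicP], the function [1 / (a phi)] has the explicit
   y-derivative [- 1 / phi]; this gives the y-derivative of its x-derivative [k],
   and, by comparing two points of a vertical line, the continuity of [T]. *)
Section NonzeroPoint.
Variables x0 y0 : C.
Hypothesis U0 : U (x0, y0).
Hypothesis a0 : a (x0, y0) <> 0.

Let P0 : C := cubicP x0 y0.
Let ratio (q : C * C) : C := cubicP (fst q) (snd q) / P0.
Let phi (q : C * C) : C := csqrt (ratio q).
Let k (q : C * C) : C := - (s q / (a q ^ 2 * phi q)) + 1 / (2 * (snd q - fst q) * a q * phi q).
Let m (q : C * C) : C := - 1 / (2 * (snd q - fst q) * phi q).
Let near (q : C * C) : Prop := U q /\ a q <> 0 /\ (0 < Re (ratio q))%R.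

Let P0_neq : P0 <> 0.
Proof.
destruct (Omega_neq _ _ (U_Omega _ U0)) as (? & ? & ? & ? & ?).
unfold P0, cubicP; nonzero.
Qed.

Let ratio_tends (q : C * C) : tends (locally q) ratio (ratio q).
Proof. unfold ratio, cubicP; repeat tends_step; exact P0_neq. Qed.

Let near_base : near (x0, y0).
Proof.
split; [exact U0|]; split; [exact a0|].
replace (ratio (x0, y0)) with (RtoC 1); [simpl; lra|].
unfold ratio; cbn [fst snd]; fold P0; field; exact P0_neq.
Qed.

Let near_open (q : C * C) : near q -> locally q near.
Proof.
intros (Uq & aq & R).
apply filter_and; [exact (U_open _ Uq)|].
apply filter_and; [exact (tends_neq _ _ aq (a_cont _ Uq))|].
exact (tends_Re_gt0 ratio _ R (ratio_tends q)).
Qed.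

Let phi_neq (q : C * C) : near q -> phi q <> 0.
Proof. intros (_ & _ & H); apply csqrt_neq, H. Qed.

Let phi_sqr (q : C * C) : near q -> phi q * phi q = ratio q.
Proof. intros (_ & _ & H); apply csqrt_sqr, H. Qed.

Let phi_y (q : C * C) : near q -> dy phi q (Cc q * phi q).
Proof.
intros N; pose proof (phi_neq _ N) as n; pose proof (phi_sqr _ N) as e.
destruct q as [x y]; destruct N as (Uq & _ & R).
pose proof (U_Omega _ Uq) as O.
unfold dy, phi, ratio; cbn [fst snd].
eapply der_eq; [apply der_csqrt; [exact R|]|].
- apply (der_div (fun t => cubicP x t) (fun _ => P0)); [exact P0_neq|apply der_cubicP|apply der_const].
- cbv beta; change (csqrt (cubicP x y / P0)) with (phi (x, y)).
  rewrite (cubicP1_eq x y O).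
  transitivity (p6C x y * (phi (x, y) * phi (x, y)) / phi (x, y)); [rewrite e; unfold ratio; cbn [fst snd]|unfold Cc; cbn [fst snd]]; field; nonzero.
Qed.

Let phi_x (q : C * C) : near q -> dx phi q (- phi q / (2 * (snd q - fst q))).
Proof.
intros N; pose proof (phi_neq _ N) as n; pose proof (phi_sqr _ N) as e.
destruct q as [x y]; destruct N as (Uq & _ & R).
destruct (Omega_neq _ _ (U_Omega _ Uq)) as (? & ? & ? & ? & ?).
unfold dx, phi, ratio; cbn [fst snd].
eapply der_eq; [apply der_csqrt; [exact R|]|].
- apply (der_div (fun t => cubicP t y) (fun _ => P0)); [exact P0_neq|apply der_cubicP_x|apply der_const].
- cbv beta; change (csqrt (cubicP x y / P0)) with (phi (x, y)).
  transitivity (- (phi (x, y) * phi (x, y)) / (2 * (y - x) * phi (x, y))); [rewrite e; unfold ratio, cubicP; cbn [fst snd]|]; field; nonzero.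
Qed.

Let phi_tends (q : C * C) : near q -> tends (locally q) phi (phi q).
Proof.
intros (_ & _ & R); apply tends_csqrt; [exact R|apply ratio_tends].
Qed.

Let inv_y (q : C * C) : near q -> dy (fun r => 1 / (a r * phi r)) q (- 1 / phi q).
Proof.
intros N; pose proof (phi_neq _ N) as n; pose proof (phi_y _ N) as e.
destruct q as [x y]; destruct N as (Uq & aq & R).
pose proof (a_y _ Uq) as ay; unfold dy in *; cbn [fst snd] in *.
derive; nonzero; field; nonzero.
Qed.

Let inv_x (q : C * C) : near q -> dx (fun r => 1 / (a r * phi r)) q (k q).
Proof.
intros N; pose proof (phi_neq _ N) as n; pose proof (phi_x _ N) as e.
destruct q as [x y]; destruct N as (Uq & aq & R).
destruct (Omega_neq _ _ (U_Omega _ Uq)) as (? & ? & ? & ? & ?).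
pose proof (a_x _ Uq) as ax; unfold dx, k in *; cbn [fst snd] in *.
derive; nonzero; field; nonzero.
Qed.

Let m_derivative (q : C * C) : near q -> dx (fun r => - 1 / phi r) q (m q).
Proof.
intros N; pose proof (phi_neq _ N) as n; pose proof (phi_x _ N) as e.
destruct q as [x y]; destruct N as (Uq & aq & R).
destruct (Omega_neq _ _ (U_Omega _ Uq)) as (? & ? & ? & ? & ?).
unfold dx, m in *; cbn [fst snd] in *.
derive; nonzero; field; nonzero.
Qed.

Let m_x (q : C * C) : near q -> dx m q (- 3 / (4 * (snd q - fst q) ^ 2 * phi q)).
Proof.
intros N; pose proof (phi_neq _ N) as n; pose proof (phi_x _ N) as e.
destruct q as [x y]; destruct N as (Uq & aq & R).
destruct (Omega_neq _ _ (U_Omega _ Uq)) as (? & ? & ? & ? & ?).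
unfold dx, m in *; cbn [fst snd] in *.
derive; nonzero; field; nonzero.
Qed.

Let m_tends (q : C * C) : near q -> tends (locally q) m (m q).
Proof.
intros N; pose proof (phi_neq _ N) as n; pose proof (phi_tends _ N) as t; destruct N as (Uq & _ & _).
destruct q as [x y]; destruct (Omega_neq _ _ (U_Omega _ Uq)) as (? & ? & ? & ? & ?).
unfold m; repeat tends_step; cbn [fst snd]; nonzero.
Qed.

Let k_y (q : C * C) : near q -> dy k q (m q).
Proof.
intros N; apply (mixed_derivative' (fun r => 1 / (a r * phi r)) (fun r => - 1 / phi r));
  [| | |exact (m_tends _ N)]; generalize (near_open _ N); apply filter_imp; intros r Nr.
- exact (inv_y _ Nr).
- exact (inv_x _ Nr).
- exact (m_derivative _ Nr).
Qed.

Let T_via_k (q : C * C) : near q ->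
  - a q ^ 2 * phi q * k q + a q / (2 * (snd q - fst q)) + a q * c q = T q.
Proof.
intros N; pose proof (phi_neq _ N) as n.
destruct q as [x y]; destruct N as (Uq & aq & R).
destruct (Omega_neq _ _ (U_Omega _ Uq)) as (? & ? & ? & ? & ?).
unfold k, T; cbn [fst snd]; field; nonzero.
Qed.

(** [T_via_k] trades [s], about which only its values are known, for [k], whose y-derivative is [m];
    differentiating that expression is then legitimate. *)
Let T_y (q : C * C) : near q -> dy T q ((3 * a q - Cc q) * T q).
Proof.
intros N; pose proof (k_y _ N) as ky; pose proof (phi_y _ N) as py; pose proof (phi_neq _ N) as n.
pose proof (near_open _ N) as NO; pose proof (T_via_k _ N) as Tk.
destruct q as [x y]; destruct N as (Uq & aq & R).
destruct (Omega_neq _ _ (U_Omega _ Uq)) as (? & ? & ? & ? & ?).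
pose proof (a_y _ Uq) as ay; pose proof (c_y _ Uq) as cy.
unfold dy in *; cbn [fst snd] in *.
apply (der_ext_loc (fun t => - a (x, t) ^ 2 * phi (x, t) * k (x, t) + a (x, t) / (2 * (t - x)) + a (x, t) * c (x, t))).
{ apply locally_slice_y in NO; revert NO; apply filter_imp; intros t Nt; exact (T_via_k _ Nt). }
derive; nonzero.
replace (s (x, y)) with (T (x, y) - a (x, y) * c (x, y)) by (unfold T; ring).
rewrite <- Tk; unfold m, E, p6E; cbn [fst snd]; field; nonzero.
Qed.

(** In y the logarithmic derivatives of [T], of the cubic and of [a ^ 3] are 3 a - C, 2 C and 3 a -
    3 C, so this quotient does not depend on y. *)
Let tau (q : C * C) : C := T q / (cubicP (fst q) (snd q) * a q ^ 3).

Let cubicP_neq (x y : C) : U (x, y) -> cubicP x y <> 0.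
Proof.
intros H; destruct (Omega_neq _ _ (U_Omega _ H)) as (? & ? & ? & ? & ?); unfold cubicP; nonzero.
Qed.

Let tau_y (q : C * C) : near q -> dy tau q 0.
Proof.
intros N; pose proof (T_y _ N) as Ty.
destruct q as [x y]; destruct N as (Uq & aq & R).
pose proof (a_y _ Uq) as ay; pose proof (cubicP_neq _ _ Uq) as Pn; pose proof (der_cubicP x y) as Py.
rewrite (cubicP1_eq x y (U_Omega _ Uq)) in Py.
unfold dy, tau in *; cbn [fst snd] in *.
derive; nonzero; unfold Cc; cbn [fst snd]; field; nonzero.
Qed.

(** [T_via_k] divided by a^2 phi, with T = tau P a^3 and P = P0 phi^2. Two points of a vertical line
    give two such equations, from which tau can be solved. *)
Let k_via_tau (q : C * C) : near q ->
  tau q * P0 * (a q * phi q) = (c q + 1 / (2 * (snd q - fst q))) / (a q * phi q) - k q.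
Proof.
intros N; pose proof (phi_neq _ N) as n; pose proof (phi_sqr _ N) as e; pose proof (T_via_k _ N) as Tk.
destruct q as [x y]; destruct N as (Uq & aq & R).
destruct (Omega_neq _ _ (U_Omega _ Uq)) as (? & ? & ? & ? & ?).
pose proof (cubicP_neq _ _ Uq) as Pn.
unfold tau; rewrite <- Tk; cbn [fst snd] in *.
assert (e2 : P0 = cubicP x y / (phi (x, y) * phi (x, y))).
{ rewrite e; unfold ratio; cbn [fst snd]; field; nonzero; exact P0_neq. }
generalize (k (x, y)); intros kk; rewrite e2; field; nonzero.
Qed.

Let v (q : C * C) : C := a q * phi q.

Let v_y (q : C * C) : near q -> dy v q (a q ^ 2 * phi q).
Proof.
intros N; pose proof (phi_y _ N) as py; pose proof (a_y _ (proj1 N)) as ay.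
destruct q as [x y]; unfold dy, v in *; cbn [fst snd] in *; derive; field; nonzero.
Qed.

Let v_tends (q : C * C) : near q -> tends (locally q) v (v q).
Proof. intros N; apply tends_mult; [exact (a_cont _ (proj1 N))|exact (phi_tends _ N)]. Qed.

(** Subtracting [k_via_tau] at heights y1 and y0 expresses the common value of [tau] on a vertical
    line through differences of [v], [k] and a continuous function [g]. Hence [tau] is continuous in
    x, and T = tau P a^3 is continuous. *)
Let T_tends : tends (locally (x0, y0)) T (T (x0, y0)).
Proof.
set (mx := fun q : C * C => - 3 / (4 * (snd q - fst q) ^ 2 * phi q)).
assert (tmx : tends (locally (x0, y0)) mx (mx (x0, y0))).
{ pose proof (phi_neq _ near_base) as n; pose proof (phi_tends _ near_base) as t.
  destruct (Omega_neq _ _ (U_Omega _ U0)) as (? & ? & ? & ? & ?).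
  unfold mx; repeat tends_step; cbn [fst snd]; nonzero. }
generalize (filter_and _ _ (near_open _ near_base) (tmx 1%R Rlt_0_1)).
rewrite locally2_Cmod; cbn [fst snd]; intros [d [d0 near_bound]].
set (M := (Cmod (mx (x0, y0)) + 1)%R).
assert (H : forall x y, (Cmod (x - x0) < d)%R -> (Cmod (y - y0) < d)%R -> near (x, y) /\ (Cmod (mx (x, y)) <= M)%R).
{ intros x y Hx Hy; destruct (near_bound x y Hx Hy) as [N bd]; split; [exact N|].
  replace (mx (x, y)) with ((mx (x, y) - mx (x0, y0)) + mx (x0, y0)) by ring.
  eapply Rle_trans; [apply Cmod_triangle|]; unfold M; lra. }
clear near_bound.
pose proof (disc_center x0 d d0) as Zx; pose proof (disc_center y0 d d0) as Zy.
(* [v] is not constant along the vertical line, because its derivative does not vanish *)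
assert (X : exists y1, (Cmod (y1 - y0) < d)%R /\ v (x0, y1) - v (x0, y0) <> 0).
{ apply NNPP; intros none.
  assert (cst : der (fun t => v (x0, t)) y0 0).
  { apply (der_ext_loc (fun _ => v (x0, y0))); [|apply der_const].
    apply locally_Cmod; exists d; split; [exact d0|]; intros y Hy.
    apply NNPP; intros ne; apply none; exists y; split; [exact Hy|].
    intros e; apply ne; replace (v (x0, y)) with (v (x0, y) - v (x0, y0) + v (x0, y0)) by ring.
    rewrite e; ring. }
  pose proof (der_unique _ _ _ _ cst (v_y _ near_base)) as e; symmetry in e; revert e.
  pose proof (phi_neq _ near_base); cbn [fst snd]; nonzero. }
destruct X as [y1 [Hy1 v_neq]].
(* The continuity of [k] in x is not known, but that of this difference follows from [k_y]: the
   explicit [m] is Lipschitz in x with constant [M], and the bound is integrated from y0 to y1. *)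
assert (Dk : tends (locally x0) (fun x => k (x, y1) - k (x, y0)) (k (x0, y1) - k (x0, y0))).
{ intros eps He.
  assert (M0 : (0 < M)%R) by (unfold M; pose proof (Cmod_ge_0 (mx (x0, y0))); lra).
  pose proof (Cmod_ge_0 (y1 - y0)) as Y0.
  assert (e0 : (0 < Rmin d (eps / (M * (Cmod (y1 - y0) + 1))))%R).
  { apply Rmin_pos; [exact d0|]; apply Rdiv_lt_0_compat; [exact He|]; apply Rmult_lt_0_compat; lra. }
  apply locally_Cmod; exists (Rmin d (eps / (M * (Cmod (y1 - y0) + 1)))); split; [exact e0|].
  intros x Hx; pose proof (Rlt_le_trans _ _ _ Hx (Rmin_l _ _)) as Hxd.
  pose proof (Rlt_le_trans _ _ _ Hx (Rmin_r _ _)) as Hxe.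
  assert (rearranged : k (x, y1) - k (x, y0) - (k (x0, y1) - k (x0, y0))
    = (k (x, y1) - k (x0, y1)) - (k (x, y0) - k (x0, y0))) by ring.
  change (Cmod (k (x, y1) - k (x, y0) - (k (x0, y1) - k (x0, y0)))%C < eps)%R.
  rewrite rearranged; eapply Rle_lt_trans.
  - apply (mean_value_inequality (fun y => k (x, y) - k (x0, y)) (fun y => m (x, y) - m (x0, y))
             y0 y1 (M * Cmod (x - x0))).
    intros y Hy; assert (Hyd : (Cmod (y - y0) < d)%R) by lra; split.
    + apply der_minus; [exact (k_y _ (proj1 (H _ _ Hxd Hyd)))|exact (k_y _ (proj1 (H _ _ Zx Hyd)))].
    + apply (mean_value_inequality (fun t => m (t, y)) (fun t => mx (t, y))).
      intros t Ht; assert (Htd : (Cmod (t - x0) < d)%R) by lra.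
      destruct (H _ _ Htd Hyd) as [Nt Bt]; split; [exact (m_x _ Nt)|exact Bt].
  - assert (K2 : (Cmod (x - x0) * (M * (Cmod (y1 - y0) + 1)) < eps)%R).
    { apply Rmult_lt_reg_r with (/ (M * (Cmod (y1 - y0) + 1)))%R.
      - apply Rinv_0_lt_compat, Rmult_lt_0_compat; lra.
      - rewrite Rmult_assoc, Rinv_r, Rmult_1_r; [exact Hxe|].
        apply Rmult_integral_contrapositive_currified; lra. }
    pose proof (Cmod_ge_0 (x - x0)); nra. }
assert (tau_const : forall x y, (Cmod (x - x0) < d)%R -> (Cmod (y - y0) < d)%R -> tau (x, y) = tau (x, y0)).
{ intros x y Hx Hy.
  assert (Z : (Cmod (tau (x, y) - tau (x, y0)) <= 0 * Cmod (y - y0))%R).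
  { apply (mean_value_inequality (fun t => tau (x, t)) (fun _ => RtoC 0)).
    intros t Ht; assert (Htd : (Cmod (t - y0) < d)%R) by lra; split.
    - exact (tau_y _ (proj1 (H _ _ Hx Htd))).
    - rewrite Cmod_0; lra. }
  rewrite Rmult_0_l in Z; pose proof (Cmod_ge_0 (tau (x, y) - tau (x, y0))).
  assert (e : tau (x, y) - tau (x, y0) = 0) by (apply Cmod_eq_0; lra).
  replace (tau (x, y)) with (tau (x, y) - tau (x, y0) + tau (x, y0)) by ring; rewrite e; ring. }
set (g := fun q : C * C => (c q + 1 / (2 * (snd q - fst q))) / (a q * phi q)).
assert (g_tends : forall y, (Cmod (y - y0) < d)%R -> tends (locally x0) (fun x => g (x, y)) (g (x0, y))).
{ intros y Hy; apply tends_slice_x; destruct (H _ _ Zx Hy) as [N _].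
  pose proof (phi_neq _ N) as n; pose proof (phi_tends _ N) as t.
  pose proof (a_cont _ (proj1 N)) as ta; pose proof (c_cont _ (proj1 N)) as tc.
  destruct N as (Uq & aq & _).
  destruct (Omega_neq _ _ (U_Omega _ Uq)) as (? & ? & ? & ? & ?).
  unfold g; repeat tends_step; cbn [fst snd]; nonzero. }
assert (v_tends_x : forall y, (Cmod (y - y0) < d)%R -> tends (locally x0) (fun x => v (x, y)) (v (x0, y))).
{ intros y Hy; apply tends_slice_x, v_tends, (proj1 (H _ _ Zx Hy)). }
assert (tau_solved : forall x, (Cmod (x - x0) < d)%R -> v (x, y1) - v (x, y0) <> 0 ->
  (g (x, y1) - g (x, y0) - (k (x, y1) - k (x, y0))) / (P0 * (v (x, y1) - v (x, y0))) = tau (x, y0)).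
{ intros x Hx vn.
  pose proof (k_via_tau _ (proj1 (H _ _ Hx Hy1))) as e1; rewrite (tau_const _ _ Hx Hy1) in e1.
  pose proof (k_via_tau _ (proj1 (H _ _ Hx Zy))) as e2.
  fold (v (x, y1)) in e1; fold (v (x, y0)) in e2.
  change (tau (x, y0) * P0 * v (x, y1) = g (x, y1) - k (x, y1)) in e1.
  change (tau (x, y0) * P0 * v (x, y0) = g (x, y0) - k (x, y0)) in e2.
  replace (g (x, y1) - g (x, y0) - (k (x, y1) - k (x, y0)))
    with ((g (x, y1) - k (x, y1)) - (g (x, y0) - k (x, y0))) by ring.
  rewrite <- e1, <- e2; field; split; [exact vn|exact P0_neq]. }
assert (tau_x : tends (locally x0) (fun x => tau (x, y0)) (tau (x0, y0))).
{ rewrite <- (tau_solved _ Zx v_neq).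
  assert (tv : tends (locally x0) (fun x => v (x, y1) - v (x, y0)) (v (x0, y1) - v (x0, y0))).
  { apply tends_minus; apply v_tends_x; assumption. }
  eapply tends_ext.
  2: { apply tends_div; [|apply tends_minus; [apply tends_minus; apply g_tends; assumption|exact Dk]
         |apply tends_mult; [apply (tends_const P0)|exact tv]].
       apply Cmult_neq_0; [exact P0_neq|exact v_neq]. }
  generalize (tends_neq _ _ v_neq tv); intros L1.
  assert (L2 : locally x0 (fun x => (Cmod (x - x0) < d)%R)).
  { apply locally_Cmod; exists d; split; [exact d0|]; intros w Hw; exact Hw. }
  generalize (filter_and _ _ L1 L2); apply filter_imp; intros x [vn Hx]; exact (tau_solved _ Hx vn). }
apply (tends_ext (fun q => tau (fst q, y0) * (cubicP (fst q) (snd q) * a q ^ 3))).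
- apply locally2_Cmod; exists d; split; [exact d0|]; cbn [fst snd]; intros x y Hx Hy.
  rewrite <- (tau_const x y Hx Hy); destruct (H _ _ Hx Hy) as [(Uq & aq & _) _].
  pose proof (cubicP_neq _ _ Uq); unfold tau; cbn [fst snd]; field; nonzero.
- replace (T (x0, y0)) with (tau (x0, y0) * (cubicP x0 y0 * a (x0, y0) ^ 3)).
  + apply tends_mult.
    * intros eps He; exact (locally_fst (x0, y0) _ (tau_x eps He)).
    * pose proof (a_cont _ U0) as ta; unfold cubicP; repeat tends_step.
  + pose proof (cubicP_neq _ _ U0); unfold tau; cbn [fst snd]; field; nonzero.
Qed.

Lemma regularity_nonzero :
  dy T (x0, y0) ((3 * a (x0, y0) - Cc (x0, y0)) * T (x0, y0)) /\
  tends (locally (x0, y0)) T (T (x0, y0)).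
Proof. exact (conj (T_y _ near_base) T_tends). Qed.

End NonzeroPoint.

(** * Prolongation of the system: mixed derivatives of [c] and of [T] *)

Section Prolongation.
Hypothesis T_y : forall p, U p -> dy T p ((3 * a p - Cc p) * T p).
Hypothesis T_tends : forall p, U p -> tends (locally p) T (T p).

(** Schwarz's theorem for [c]: its x-derivative can be differentiated in y by the equations, with a
    result [mm] that is continuous because [T] is, and its y-derivative is T + a c + E. Removing a c
    and E leaves the x-derivative of [T]. *)
Lemma prolonged_x (p : C * C) : U p -> dx T p ((B p - 3 * c p) * T p + K p).
Proof.
intros Up.
set (mm := fun q : C * C =>
  K q - B q * E q + 1 / (snd q - fst q) ^ 3
  + (2 * E q * c q + B q * (T q + a q * c q + E q)) - 2 * c q * (T q + a q * c q + E q)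
  + (a q ^ 2 - Cc q * a q) * A q + a q * (W q + Cc q * A q)).
assert (M : dx (fun q => T q + a q * c q + E q) p (mm p)).
{ apply (mixed_derivative c (fun q => W q + B q * c q - c q ^ 2 + a q * A q)).
  - generalize (U_open _ Up); apply filter_imp; exact c_x.
  - generalize (U_open _ Up); apply filter_imp; intros q Uq; unfold dy.
    eapply der_eq; [exact (c_y _ Uq)|unfold T; ring].
  - generalize (U_open _ Up); apply filter_imp; intros [x y] Uq.
    pose proof (U_Omega _ Uq) as O; destruct (Omega_neq _ _ O) as (? & ? & ? & ? & ?).
    pose proof (c_y _ Uq) as cy; pose proof (a_y _ Uq) as ay.
    pose proof (der_p6W al be ga de x y O) as Wy; pose proof (der_p6B x y O) as By.
    pose proof (der_p6A al be ga de x y O) as Ay.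
    unfold dy, mm, T, A, B, Cc, E, W, K in *; cbn [fst snd] in *; derive; field; nonzero.
  - pose proof (U_Omega _ Up) as O; pose proof (T_tends _ Up) as tT; pose proof (a_cont _ Up) as ta.
    pose proof (c_cont _ Up) as tc.
    destruct p as [x y]; destruct (Omega_neq _ _ O) as (? & ? & ? & ? & ?).
    unfold mm, A, B, Cc, E, W, K, p6A, p6B, p6C, p6E, p6W, p6K, p6R, p6R1, p6R2, cubicP, cubicP1, cubicP2.
    repeat tends_step; cbn [fst snd]; nonzero. }
destruct p as [x y]; pose proof (U_Omega _ Up) as O; destruct (Omega_neq _ _ O) as (? & ? & ? & ? & ?).
pose proof (c_x _ Up) as cx; pose proof (a_x _ Up) as ax; pose proof (der_p6E_x x y O) as Ex.
unfold dx in *; cbn [fst snd] in *.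
apply (der_ext_loc (fun t => (T (t, y) + a (t, y) * c (t, y) + E (t, y)) - a (t, y) * c (t, y) - E (t, y))).
{ apply filter_forall; intros t; ring. }
change (der (fun t => E (t, y)) x (1 / (y - x) ^ 3)) in Ex.
eapply der_eq.
- apply der_minus; [apply der_minus; [exact M|]|exact Ex].
  apply (der_mult (fun t => a (t, y)) (fun t => c (t, y))); [exact ax|exact cx].
- cbv beta; replace (s (x, y)) with (T (x, y) - a (x, y) * c (x, y)) by (unfold T; ring).
  unfold mm; cbn [fst snd]; change (UniformSpace.sort C_UniformSpace) with C; field; nonzero.
Qed.

(** Schwarz's theorem for [T]. The square appears because 3 a_x = 3 (T - a c) enters one mixed
    derivative and -3 c_y = -3 (T + a c + E) the other, each multiplied by T. *)
Lemma prolongation_compatibility (p : C * C) : U p ->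
  6 * T p ^ 2 = K1 p + Cc p * K p - 3 * a p * K p.
Proof.
intros Up.
set (mm := fun q : C * C =>
  (3 * (T q - a q * c q) - E q) * T q + (3 * a q - Cc q) * ((B q - 3 * c q) * T q + K q)).
assert (M : dy (fun q => (B q - 3 * c q) * T q + K q) p (mm p)).
{ apply (mixed_derivative' T (fun q => (3 * a q - Cc q) * T q)).
  - generalize (U_open _ Up); apply filter_imp; exact T_y.
  - generalize (U_open _ Up); apply filter_imp; exact prolonged_x.
  - generalize (U_open _ Up); apply filter_imp; intros [x y] Uq.
    pose proof (U_Omega _ Uq) as O; destruct (Omega_neq _ _ O) as (? & ? & ? & ? & ?).
    pose proof (prolonged_x _ Uq) as Tx; pose proof (a_x _ Uq) as ax.
    pose proof (der_p6C_x x y O) as Cx.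
    replace (s (x, y)) with (T (x, y) - a (x, y) * c (x, y)) in ax by (unfold T; ring).
    unfold dx, mm, Cc, E in *; cbn [fst snd] in *; derive; field; nonzero.
  - pose proof (U_Omega _ Up) as O; pose proof (T_tends _ Up) as tT; pose proof (a_cont _ Up) as ta.
    pose proof (c_cont _ Up) as tc.
    destruct p as [x y]; destruct (Omega_neq _ _ O) as (? & ? & ? & ? & ?).
    unfold mm, A, B, Cc, E, W, K, p6A, p6B, p6C, p6E, p6W, p6K, p6R, p6R1, p6R2, cubicP, cubicP1, cubicP2.
    repeat tends_step; cbn [fst snd]; nonzero. }
destruct p as [x y]; pose proof (U_Omega _ Up) as O; destruct (Omega_neq _ _ O) as (? & ? & ? & ? & ?).
pose proof (c_y _ Up) as cy; pose proof (T_y _ Up) as Ty; pose proof (der_p6B x y O) as By.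
pose proof (der_p6K al be ga de x y O) as Ky.
change (der (fun t => B (x, t)) y (2 * E (x, y))) in By.
change (der (fun t => K (x, t)) y (K1 (x, y))) in Ky.
replace (s (x, y)) with (T (x, y) - a (x, y) * c (x, y)) in cy by (unfold T; ring).
unfold dy in *; cbn [fst snd] in *.
assert (N : der (fun t => (B (x, t) - 3 * c (x, t)) * T (x, t) + K (x, t)) y
  ((2 * E (x, y) - 3 * (T (x, y) + a (x, y) * c (x, y) + E (x, y))) * T (x, y)
   + (B (x, y) - 3 * c (x, y)) * ((3 * a (x, y) - Cc (x, y)) * T (x, y)) + K1 (x, y))).
{ derive; ring. }
pose proof (der_unique _ _ _ _ M N) as e; unfold mm in e; cbn [fst snd] in e; change (UniformSpace.sort C_UniformSpace) with C in *.
match type of e with ?l = ?r => assert (z : l - r = 0) by (rewrite e; ring) end.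
replace (K1 (x, y) + Cc (x, y) * K (x, y) - 3 * a (x, y) * K (x, y)) with
  (K1 (x, y) + Cc (x, y) * K (x, y) - 3 * a (x, y) * K (x, y) + 0) by ring.
rewrite <- z; ring.
Qed.
End Prolongation.
End Foliation.

(** * Elimination of [T] on a vertical line *)

Section SlopeElimination.
Variables (x y0 : C) (d : R) (e : C).
Variables p0 q0 p1 q1 p2 q2 p3 G a T K1 : C -> C.

Let disc (y : C) : Prop := (Cmod (y - y0) < d)%R.
Let P (y : C) : C := cubicP x y.

Hypothesis disc_Omega : forall y, disc y -> Omega (x, y).
Hypothesis G_neq : forall y, disc y -> G y <> 0.
Hypothesis der_G : forall y, disc y -> der G y (- 2 * e * p6C x y * G y).
Hypothesis der_a : forall y, disc y -> der a y (a y ^ 2 - p6C x y * a y).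
Hypothesis der_T : forall y, disc y -> der T y ((3 * a y - p6C x y) * T y).
Hypothesis der_p0 : forall y, disc y -> der p0 y (q0 y).
Hypothesis der_p1 : forall y, disc y -> der p1 y (q1 y).
Hypothesis der_p2 : forall y, disc y -> der p2 y (q2 y).
Hypothesis p1_eq : forall y, disc y -> p1 y = P y * q0 y + (1 / 2 - e) * cubicP1 x y * p0 y.
Hypothesis p2_eq : forall y, disc y -> p2 y = P y * q1 y + (- e) * cubicP1 x y * p1 y.
Hypothesis p3_eq : forall y, disc y -> p3 y = P y * q2 y + (- (1 / 2) - e) * cubicP1 x y * p2 y.
Hypothesis der_K : forall y, disc y -> der (fun t => p0 t * G t) y (K1 y).
Hypothesis square_relation : forall y, disc y ->
  6 * T y ^ 2 = K1 y + p6C x y * (p0 y * G y) - 3 * a y * (p0 y * G y).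

Let disc_locally (y : C) : disc y -> locally y disc.
Proof.
intros Hy; apply locally_Cmod; exists (d - Cmod (y - y0))%R; unfold disc in *.
split; [lra|]; intros w Hw.
replace (w - y0) with ((w - y) + (y - y0)) by ring.
eapply Rle_lt_trans; [apply Cmod_triangle|lra].
Qed.

Let der_zero (f : C -> C) (y l : C) : disc y -> (forall t, disc t -> f t = 0) -> der f y l -> l = 0.
Proof.
intros Hy H Hf; apply (der_unique f y); [exact Hf|].
apply (der_ext_loc (fun _ => RtoC 0)); [|apply der_const].
generalize (disc_locally _ Hy); apply filter_imp; intros t Ht; symmetry; exact (H t Ht).
Qed.

Let P_neq (y : C) : disc y -> P y <> 0.
Proof.
intros Hy; destruct (Omega_neq _ _ (disc_Omega _ Hy)) as (? & ? & ? & ? & ?).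
unfold P, cubicP; nonzero.
Qed.

Let der_P (y : C) : disc y -> der P y (2 * p6C x y * P y).
Proof. intros Hy; unfold P; rewrite <- (cubicP1_eq _ _ (disc_Omega _ Hy)); apply der_cubicP. Qed.

Let P1_eq (y : C) : disc y -> cubicP1 x y = 2 * p6C x y * P y.
Proof. intros Hy; exact (cubicP1_eq _ _ (disc_Omega _ Hy)). Qed.

Let square_relation' (y : C) : disc y ->
  6 * T y ^ 2 - (p1 y * G y / P y - 3 * a y * (p0 y * G y)) = 0.
Proof.
intros Hy; rewrite (square_relation _ Hy), (p1_eq _ Hy), (P1_eq _ Hy).
pose proof (der_p0 _ Hy); pose proof (der_G _ Hy); pose proof (P_neq _ Hy).
assert (e1 : der (fun t => p0 t * G t) y (q0 y * G y + p0 y * (- 2 * e * p6C x y * G y))) by (derive; ring).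
rewrite (der_unique _ _ _ _ (der_K _ Hy) e1); field; nonzero.
Qed.

(** Put K = p0 G, L1 = K' + C K and L2 = L1' + 2 C L1, so that 6 T^2 = L1 - 3 a K. As T' is a
    multiple of T, differentiating gives T^2 again, which is replaced by the same relation. What
    remains is 15 K a^2 - 9 L1 a + L2 = 0, here multiplied by P^2 / G. *)
Lemma slope_quadratic (y : C) : disc y ->
  15 * P y ^ 2 * p0 y * a y ^ 2 - 9 * P y * p1 y * a y + p2 y = 0.
Proof.
intros Hy; pose proof (P_neq _ Hy); pose proof (G_neq _ Hy).
set (X' := 12 * (3 * a y - p6C x y) * T y ^ 2
   - ((q1 y - 2 * (e + 1) * p6C x y * p1 y) * G y / P y
      - 3 * (a y ^ 2 - p6C x y * a y) * (p0 y * G y)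
      - 3 * a y * ((q0 y - 2 * e * p6C x y * p0 y) * G y))).
assert (D : X' = 0).
{ apply (der_zero (fun t => 6 * T t ^ 2 - (p1 t * G t / P t - 3 * a t * (p0 t * G t))) y _ Hy square_relation').
  pose proof (der_p0 _ Hy); pose proof (der_p1 _ Hy); pose proof (der_G _ Hy); pose proof (der_a _ Hy).
  pose proof (der_T _ Hy); pose proof (der_P _ Hy).
  derive; nonzero; unfold X'; field; nonzero. }
pose proof (square_relation' _ Hy) as S.
transitivity (P y ^ 2 / G y * (- X' + 2 * (3 * a y - p6C x y) *
  (6 * T y ^ 2 - (p1 y * G y / P y - 3 * a y * (p0 y * G y))))).
2: { rewrite S, D; ring. }
unfold X'; rewrite (p2_eq _ Hy), (p1_eq _ Hy), (P1_eq _ Hy); field; nonzero.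
Qed.

(** With L3 = L2' + 3 C L2, differentiating the quadratic and reducing a^3 by it gives 24 L1 a^2 -
    11 L2 a + L3 = 0. Cancelling a^2 between the two quadratics produces 216 = 24 * 9 and 165 = 15 *
    11. *)
Lemma slope_rational (y : C) : disc y ->
  P y * a y * (216 * p1 y ^ 2 - 165 * p0 y * p2 y) = 24 * p1 y * p2 y - 15 * p0 y * p3 y.
Proof.
intros Hy; pose proof (P_neq _ Hy).
set (Q' := 60 * p6C x y * P y ^ 2 * p0 y * a y ^ 2 + 15 * P y ^ 2 * q0 y * a y ^ 2
  + 30 * P y ^ 2 * p0 y * a y * (a y ^ 2 - p6C x y * a y)
  - 18 * p6C x y * P y * p1 y * a y - 9 * P y * q1 y * a y
  - 9 * P y * p1 y * (a y ^ 2 - p6C x y * a y) + q2 y).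
assert (D : Q' = 0).
{ apply (der_zero (fun t => 15 * P t ^ 2 * p0 t * a t ^ 2 - 9 * P t * p1 t * a t + p2 t) y _ Hy slope_quadratic).
  pose proof (der_p0 _ Hy); pose proof (der_p1 _ Hy); pose proof (der_p2 _ Hy); pose proof (der_a _ Hy).
  pose proof (der_P _ Hy).
  derive; nonzero; unfold Q'; ring. }
pose proof (slope_quadratic _ Hy) as S.
match type of S with ?l = _ => set (Q := l) in S end.
(* The multiple of [Q] added to [Q'] removes the stray terms in C and the cubic term in [a];
   subtracting [24 * p1 y * Q] removes the square. *)
assert (Z : 15 * p0 y * (P y * Q' + P y * Q * (- 2 * e * p6C x y - p6C x y - 2 * a y)) - 24 * p1 y * Q = 0)
  by (rewrite S, D; ring).
assert (q0_eq : q0 y = (p1 y - (1 / 2 - e) * (2 * p6C x y * P y) * p0 y) / P y)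
  by (rewrite (p1_eq _ Hy), (P1_eq _ Hy); field; nonzero).
assert (q1_eq : q1 y = (p2 y + e * (2 * p6C x y * P y) * p1 y) / P y)
  by (rewrite (p2_eq _ Hy), (P1_eq _ Hy); field; nonzero).
assert (q2_eq : q2 y = (p3 y + (1 / 2 + e) * (2 * p6C x y * P y) * p2 y) / P y)
  by (rewrite (p3_eq _ Hy), (P1_eq _ Hy); field; nonzero).
match goal with |- ?l = ?r => transitivity (r + 0); [rewrite <- Z|ring] end.
unfold Q', Q; rewrite q0_eq, q1_eq, q2_eq; field; nonzero.
Qed.

(** This is h' = P' / (2 P) h - 1 for h = D / N = 1 / a, cleared of denominators. *)
Lemma slope_quotient (N D N1 D1 : C -> C) :
  (forall y, disc y -> a y * D y = N y) ->
  (forall y, disc y -> der N y (N1 y)) -> (forall y, disc y -> der D y (D1 y)) ->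
  forall y, disc y ->
  2 * P y * (D1 y * N y - D y * N1 y) = cubicP1 x y * D y * N y - 2 * P y * N y ^ 2.
Proof.
intros aD dN dD y Hy.
assert (Z : (a y ^ 2 - p6C x y * a y) * D y + a y * D1 y - N1 y = 0).
{ apply (der_zero (fun t => a t * D t - N t) y); [exact Hy|intros t Ht; rewrite (aD t Ht); ring|].
  pose proof (der_a _ Hy); pose proof (dN _ Hy); pose proof (dD _ Hy); derive; ring. }
assert (e1 : N1 y = (a y ^ 2 - p6C x y * a y) * D y + a y * D1 y).
{ transitivity (N1 y + 0); [ring|rewrite <- Z; ring]. }
rewrite e1, <- (aD y Hy), (P1_eq _ Hy); ring.
Qed.

Lemma slope_vanishing (D : C -> C) : (forall y, disc y -> a y * D y = 0) ->
  forall y, disc y -> p2 y * D y ^ 2 = 0.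
Proof.
intros aD y Hy; transitivity
  ((15 * P y ^ 2 * p0 y * a y ^ 2 - 9 * P y * p1 y * a y + p2 y) * D y ^ 2
   - 15 * P y ^ 2 * p0 y * (a y * D y) ^ 2 + 9 * P y * p1 y * D y * (a y * D y)); [ring|].
rewrite (slope_quadratic _ Hy), (aD y Hy); ring.
Qed.

End SlopeElimination.

(** * Polynomial algebra: rational solutions and the pivot *)

Module RiccatiRational.
Import all_boot all_order all_algebra ring zify.
Import Order.TTheory GRing.Theory Num.Theory.
Set Implicit Arguments.
Unset Strict Implicit.
Local Open Scope ring_scope.

Definition cubic (F : fieldType) (x : F) : {poly F} := 'X * ('X - 1%:P) * ('X - x%:P).

Lemma cubic_root (F : fieldType) (x r : F) : root (cubic x) r = [|| r == 0, r == 1 | r == x].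
Proof.
by rewrite /cubic !rootM !root_XsubC -{1}['X]subr0 -polyC0 root_XsubC -orbA.
Qed.

Lemma cubic_monic (F : fieldType) (x : F) : cubic x \is monic.
Proof. by rewrite /cubic !monicMl ?monicX ?monicXsubC. Qed.

Lemma size_cubic (F : fieldType) (x : F) : size (cubic x) = 4%N.
Proof.
by rewrite /cubic !size_monicM ?monicMl ?monicX ?monicXsubC ?polyXsubC_eq0 ?size_polyX ?size_XsubC.
Qed.

Lemma size_deriv (R : numDomainType) (p : {poly R}) : size p^`() = (size p).-1.
Proof.
have [lep1|lt1p] := leqP (size p) 1.
  by rewrite {1}[p]size1_polyC // derivC size_poly0 -subn1 (eqnP lep1).
rewrite size_poly_eq // mulrn_eq0 -subn2 -subSn // subn2.
by rewrite lead_coef_eq0 -size_poly_eq0 -(subnKC lt1p).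
Qed.

(* [m] is the multiplicity of [r] as a root of [D]. *)
Lemma logderiv_at_simple_root (F : numFieldType) (P D S : {poly F}) (r : F) :
  D != 0 -> root P r -> P * D^`() = S * D -> exists m : nat, S.[r] = m%:R * P^`().[r].
Proof.
move=> D0 /factor_theorem[Q ->] E.
have [m [D1 nr eD]] := multiplicity_XsubC D r.
rewrite D0 /= in nr; exists m; have nr' : D1.[r] != 0 by [].
have X0 : 'X - r%:P != 0 :> {poly F} by rewrite polyXsubC_eq0.
have : (Q * (D1^`() * ('X - r%:P) + D1 *+ m)) = S * D1.
  apply: (mulIf (expf_neq0 m X0)).
  rewrite -[RHS]mulrA -eD -E eD derivM deriv_exp derivXsubC mul1r.
  (* The derivative of the power has exponent [m.-1], so m = 0 is treated apart. *)
  case: m {eD} => [|m]; first by rewrite expr0 mulr0n !mulr1 mulr0 !addr0; ring.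
  by rewrite /= exprS; ring.
move=> /(congr1 (horner^~ r)).
rewrite !hornerE subrr mulr0 add0r hornerMn derivM derivXsubC !hornerE subrr mulr0 add0r.
rewrite -mulr_natl => e; apply: (mulIf nr'); rewrite -e; ring.
Qed.

(* [h = N / D] would solve [h' = P' / (2 P) * h - 1]. *)
Lemma no_rational_solution (F : numFieldType) (x : F) (N D : {poly F}) :
  x != 0 -> x != 1 -> D != 0 ->
  2%:R * cubic x * (N^`() * D - N * D^`()) = (cubic x)^`() * N * D - 2%:R * cubic x * D ^+ 2 ->
  False.
Proof.
move=> x0 x1 D0; have [P eP] : exists P, P = cubic x by exists (cubic x).
rewrite -eP => E.
have two0 : 2%:R != 0 :> F by rewrite pnatr_eq0.
have P0 : P != 0 by rewrite eP monic_neq0 ?cubic_monic.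
pose g := gcdp N D.
have g0 : g != 0 by rewrite gcdp_eq0 negb_and D0 orbT.
(* Both sides are homogeneous of degree 2 in (N, D), up to terms in the derivative of the common
   factor [g] that cancel. *)
wlog cop : N D D0 E {g g0} / coprimep N D.
  move=> /(_ (N %/ g) (D %/ g)); apply.
  - by rewrite dvdp_div_eq0 ?dvdp_gcdr.
  - have eN : N = N %/ g * g by rewrite divpK ?dvdp_gcdl.
    have eD : D = D %/ g * g by rewrite divpK ?dvdp_gcdr.
    move: (N %/ g) (D %/ g) eN eD => N1 D1 eN eD.
    have E0 := subrr (2%:R * P * (N^`() * D - N * D^`())); rewrite {2}E eN eD [(N1 * g)^`()]derivM [(D1 * g)^`()]derivM in E0.
    apply: (mulIf (expf_neq0 2 g0)); apply: subr0_eq; rewrite -E0; ring.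
  - by rewrite coprimep_div_gcd // D0 orbT.
have E0 : 2%:R * P * (N^`() * D - N * D^`()) - (P^`() * N * D - 2%:R * P * D ^+ 2) = 0.
  by rewrite E subrr.
(* Modulo D the equation reads 2 P N D' = 0, and N is prime to D. *)
have dvd : D %| P * D^`().
  have : D %| 2%:R *: (P * D^`() * N).
    apply/dvdpP; exists (2%:R * P * N^`() - P^`() * N + 2%:R * P * D).
    by apply: subr0_eq; rewrite scaler_nat -mulr_natl -[RHS]oppr0 -E0; ring.
  by rewrite dvdpZr // Gauss_dvdpl // coprimep_sym.
have [S eS] := dvdpP _ _ dvd.
have E2 : N * (P^`() + 2%:R * S) = 2%:R * P * (N^`() + D).
  have E1 : 2%:R * N * (P * D^`() - S * D) = 0 by rewrite eS subrr mulr0.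
  apply: (mulIf D0); apply: subr0_eq; rewrite -[RHS]subr0 -{1}oppr0 -{1}E0 -E1; ring.
have P'_neq0 r : root P r -> P^`().[r] != 0.
  rewrite eP cubic_root /cubic !derivM !derivXsubC derivX => rP.
  rewrite !hornerE; case/or3P: rP => /eqP->; rewrite !(subrr, mulr0, mul0r, add0r, addr0, mul1r, mulr1).
  - by rewrite mulN1r opprK.
  - by rewrite subr_eq0 eq_sym.
  - by rewrite mulf_neq0 // subr_eq0.
(* At a root of P, [E2] becomes N(r) (1 + 2 m) P'(r) = 0 with m a multiplicity, and 1 + 2 m is
   nonzero in characteristic 0. *)
have N_root r : root P r -> root N r.
  move=> rP; apply/negPn/negP=> nN.
  have [m eSr] := logderiv_at_simple_root D0 rP eS.
  have Pr0 : P.[r] = 0 by apply/eqP.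
  have := congr1 (horner^~ r) E2; rewrite /= -polyC_natr !(hornerM, hornerD, hornerC) Pr0 mulr0 mul0r eSr => /eqP.
  rewrite mulf_eq0 (negPf nN : (N.[r] == 0) = false) /= mulrA -{1}[P^`().[r]]mul1r -mulrDl mulf_eq0 (negPf (P'_neq0 _ rP)) orbF.
  by rewrite -natrM nat1r pnatr_eq0.
have S_root r : root P r -> root S r.
  move=> rP; have nD := coprimep_root cop (N_root r rP).
  have Pr0 : P.[r] = 0 by apply/eqP.
  have := congr1 (horner^~ r) eS; rewrite /= !hornerM Pr0 mul0r => /esym/eqP.
  by rewrite mulf_eq0 (negPf nD) orbF.
have us : uniq_roots [:: 0; 1; x].
  by rewrite uniq_rootsE /= !inE negb_or eq_sym oner_eq0 eq_sym x0 eq_sym x1.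
(* Otherwise P D' = S D gives S degree 2, yet S vanishes at the three distinct roots of P. *)
have D'0 : D^`() = 0.
  apply/eqP/negPn/negP=> nD'.
  have S0 : S != 0 by apply: contra_neq (mulf_neq0 P0 nD') => S0; rewrite eS S0 mul0r.
  have sS : (size S <= 3)%N.
    have := size_mul P0 nD'; rewrite eS size_mul // eP size_cubic.
    have := size_deriv D; have : (0 < size D)%N by rewrite size_poly_gt0.
    move: (size D) (size D^`()) (size S) => d d' s.
    by lia.
  have rs : all (root S) [:: 0; 1; x] by rewrite /= !S_root ?eP ?cubic_root ?eqxx ?orbT.
  by have := max_ring_poly_roots S0 rs us; rewrite /= ltnNge sS.
have dvdP : P %| N.
  have -> : P = \prod_(z <- [:: 0; 1; x]) ('X - z%:P).
    by rewrite 3!big_cons big_nil polyC0 subr0 mulr1 eP /cubic mulrA.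
  by apply: uniq_roots_dvdp us; rewrite /= !N_root ?eP ?cubic_root ?eqxx ?orbT.
have [M eN] := dvdpP _ _ dvdP.
(* With D constant and N = M P the equation is 2 M' P + M P' = -2 D; multiplied by M, its left side
   is an exact derivative. That derivative has degree 2 deg M + 2, while the right side has degree
   deg M. *)
have eD : M * (-2%:R * D) = (M * M * P)^`().
  have E1 : N^`() * D - N * D^`() = (M^`() * P + M * P^`()) * D by rewrite D'0 mulr0 subr0 eN derivM.
  apply: (mulIf (mulf_neq0 P0 D0)); move: E0; rewrite E1 eN !derivM => E0.
  apply: subr0_eq; rewrite -[RHS](mulr0 (- M)) -E0; ring.
have M0 : M != 0.
  apply: contra_neq D0 => M0; move: E; rewrite eN M0 D'0 !(mul0r, mulr0) derivC !(mul0r, mulr0, subr0, sub0r).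
  move=> /esym/eqP; rewrite oppr_eq0 !mulf_eq0 (negPf P0) -polyC_natr polyC_eq0 (negPf two0) /= orbb.
  by move/eqP.
have D1 : (size D <= 1)%N by move: (size_deriv D); rewrite D'0 size_poly0; case: (size D) => [|[|d]].
have sM : (0 < size M)%N by rewrite size_poly_gt0.
have sD : size (- 2%:R * D) = size D by rewrite mulNr size_polyN mulr_natl -scaler_nat size_scale.
have := congr1 (fun p : {poly F} => size p) eD.
have D2 : - 2%:R * D != 0 by rewrite -size_poly_gt0 sD size_poly_gt0.
rewrite /= size_deriv (size_mul M0 D2) sD !size_mul ?mulf_neq0 // eP size_cubic.
by move: sM D1; move: (size D) (size M) => d m; lia.
Qed.

(* Write [K = k0 G] with [G' = - e (P' / P) G] and [C = P' / (2 P)].  Then the iterated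
   derivatives [K' + C K], [(_)' + 2 C _], [(_)' + 3 C _] are [k_i G / P^i] for the
   polynomials [prolong1], [prolong2], [prolong3] below. *)
Definition prolong (F : fieldType) (P k : {poly F}) (c : F) : {poly F} :=
  P * k^`() + c%:P * P^`() * k.

Lemma prolong_at_root (F : fieldType) (P k : {poly F}) (c r : F) :
  root P r -> (prolong P k c).[r] = c * P^`().[r] * k.[r].
Proof. by move=> /rootP Pr; rewrite /prolong hornerD !hornerM Pr mul0r add0r hornerC. Qed.

Section Prolong.
Variables (F : numFieldType) (P k0 : {poly F}) (e : F).

(** For f = k G / P^i, the function f' + (i + 1) C f has numerator P k' + ((1 - i) / 2 - e) P' k
    over P^(i + 1); the constants here are the cases i = 0, 1, 2. *)
Definition prolong1 := prolong P k0 (2%:R^-1 - e).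
Definition prolong2 := prolong P prolong1 (- e).
Definition prolong3 := prolong P prolong2 (- 2%:R^-1 - e).
Definition pivot := 216%:R * prolong1 ^+ 2 - 165%:R * k0 * prolong2.
Definition numerator := 24%:R * prolong1 * prolong2 - 15%:R * k0 * prolong3.

Lemma prolong2_at_root (r : F) : root P r ->
  prolong2.[r] = - e * (2%:R^-1 - e) * P^`().[r] ^+ 2 * k0.[r].
Proof. by move=> Pr; rewrite !prolong_at_root //; ring. Qed.

(** At a root of P each prolongation is multiplication by a constant times P'(r), and 216 (1/2 -
    e)^2 + 165 e (1/2 - e) factors as shown. Neither factor vanishes at a natural number e. *)
Lemma pivot_at_root (r : F) : root P r ->
  pivot.[r] = (2%:R^-1 - e) * (108%:R - 51%:R * e) * P^`().[r] ^+ 2 * k0.[r] ^+ 2.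
Proof.
move=> Pr; rewrite /pivot -!polyC_natr hornerD hornerN !hornerM !hornerC.
by rewrite prolong2_at_root // /prolong1 prolong_at_root //; field.
Qed.
End Prolong.

End RiccatiRational.

(** * Evaluation of polynomials at Coquelicot's complex numbers *)

Lemma disc_sequence (y : C) (d : R) : (0 < d)%R ->
  exists f : nat -> C, (forall m n, f m = f n -> m = n) /\ forall n, (Cmod (f n - y) < d)%R.
Proof.
(* The shift by 2 keeps the point with n = 0 strictly inside the disc. *)
intros d0; exists (fun n => y + RtoC (d / (INR n + 2))); split.
- intros m n e; apply INR_eq.
  assert (e2 : RtoC (d / (INR m + 2)) = RtoC (d / (INR n + 2))).
  { replace (RtoC (d / (INR m + 2))) with (y + RtoC (d / (INR m + 2)) - y) by ring.
    rewrite e; ring. }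
  apply RtoC_inj in e2; pose proof (pos_INR m); pose proof (pos_INR n).
  assert (e3 : (d * (INR n + 2) = d * (INR m + 2))%R).
  { replace (d * (INR n + 2))%R with (d / (INR m + 2) * (INR m + 2) * (INR n + 2))%R by (field; lra).
    rewrite e2; field; lra. }
  apply Rmult_eq_reg_l in e3; lra.
- intros n; pose proof (pos_INR n).
  replace (y + RtoC (d / (INR n + 2)) - y) with (RtoC (d / (INR n + 2))) by ring.
  rewrite Cmod_R, Rabs_pos_eq by (apply Rlt_le, Rdiv_lt_0_compat; lra).
  apply Rmult_lt_reg_r with (INR n + 2)%R; [lra|].
  unfold Rdiv; rewrite Rmult_assoc, Rinv_l, Rmult_1_r by lra; nra.
Qed.

Module Evaluation.
Import all_boot all_order all_algebra complex Rstruct.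
Import Order.TTheory GRing.Theory Num.Theory.
Local Open Scope ring_scope.

Definition toC (z : complex R) : C := let: Complex a b := z in (a, b).
Definition ofC (z : C) : complex R := Complex z.1 z.2.

Lemma toCK : cancel toC ofC. Proof. by case. Qed.
Lemma ofCK : cancel ofC toC. Proof. by case. Qed.

Lemma toCD (u v : complex R) : toC (u + v) = Cplus (toC u) (toC v).
Proof. by case: u v => [a b] [c d]. Qed.
Lemma toCN (u : complex R) : toC (- u) = Copp (toC u).
Proof. by case: u => [a b]. Qed.
Lemma toCM (u v : complex R) : toC (u * v) = Cmult (toC u) (toC v).
Proof. by case: u v => [a b] [c d]. Qed.
Lemma toC1 : toC 1 = RtoC 1. Proof. by []. Qed.

(** Roots, gcds and degrees are handled on [{poly complex R}], derivatives on C; [ev] carries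
    statements from one to the other. *)
Definition ev (p : {poly complex R}) (z : C) : C := toC p.[ofC z].

Lemma evD p q z : ev (p + q) z = Cplus (ev p z) (ev q z).
Proof. by rewrite /ev hornerD toCD. Qed.
Lemma evN p z : ev (- p) z = Copp (ev p z).
Proof. by rewrite /ev hornerN toCN. Qed.
Lemma evM p q z : ev (p * q) z = Cmult (ev p z) (ev q z).
Proof. by rewrite /ev hornerM toCM. Qed.
Lemma evC c z : ev (ofC c)%:P z = c.
Proof. by rewrite /ev hornerC ofCK. Qed.
Lemma evX z : ev 'X z = z.
Proof. by rewrite /ev hornerX ofCK. Qed.
Lemma ev_0 z : ev 0 z = RtoC 0.
Proof. by rewrite /ev horner0. Qed.
Lemma ev_1 z : ev 1 z = RtoC 1.
Proof. by rewrite /ev hornerC. Qed.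

Lemma der_ev p z : der (ev p) z (ev p^`() z).
Proof.
elim/poly_ind: p => [|p c IH].
  apply: (der_ext_loc (fun _ => RtoC 0)); last by rewrite derivC ev_0; apply: der_const.
  by apply: filter_forall => w; rewrite ev_0.
have evE w : ev (p * 'X + c%:P) w = Cplus (Cmult (ev p w) w) (toC c).
  by rewrite evD evM evX /ev hornerC.
apply: (der_ext_loc (fun w => Cplus (Cmult (ev p w) w) (toC c))).
  by apply: filter_forall => w; rewrite evE.
apply: der_eq.
  by apply: der_plus; [apply: der_mult; [exact: IH | exact: der_id] | exact: der_const].
rewrite derivD derivM derivX derivC mulr1 addr0 evD evM evX.
by rewrite Cplus_0_r Cmult_1_r.
Qed.

Lemma ev_nat n z : ev n%:R z = RtoC (INR n).
Proof.
elim: n => [|n IH]; first by rewrite ev_0.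
by rewrite -addn1 natrD evD IH ev_1 -RtoC_plus plus_INR.
Qed.

(** The disc contains [size p] distinct points, more than a nonzero [p] has roots. *)
Lemma ev_eq0_on_disc p (y : C) (d : R) : Rlt (IZR 0) d ->
  (forall z, Rlt (Cmod (Cminus z y)) d -> ev p z = RtoC (IZR 0)) -> p = 0.
Proof.
move=> d0 pz; apply/eqP/negPn/negP => p0.
have [f [f_inj f_disc]] := disc_sequence y d d0.
pose s := [seq ofC (f n) | n <- iota 0 (size p)].
have us : uniq s by rewrite map_inj_uniq ?iota_uniq // => m n /(can_inj ofCK) /f_inj.
have rs : all (root p) s.
  apply/allP => _ /mapP[n _ ->]; apply/eqP; apply: (can_inj toCK).
  exact: pz (f_disc n).
by have := max_poly_roots p0 rs us; rewrite size_map size_iota ltnn.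
Qed.
End Evaluation.

(** * Transfer of the polynomial statements to functions on C *)

Module PolynomialContradiction.
Import all_boot all_order all_algebra complex Rstruct.
Import Order.TTheory GRing.Theory Num.Theory.
Import RiccatiRational Evaluation.
Delimit Scope C_scope with C.
Local Open Scope ring_scope.

Lemma toC_nat n : toC n%:R = RtoC (INR n).
Proof. by rewrite -(ev_nat n (RtoC (IZR 0))) /ev -polyC_natr hornerC. Qed.

Lemma toC_half : toC 2%:R^-1 = (RtoC (IZR 1) / RtoC (IZR 2))%C.
Proof.
have n2 : 2%:R != 0 :> complex R by rewrite pnatr_eq0.
rewrite -[RHS]ofCK; congr toC; apply: (mulfI n2); apply: (can_inj toCK).
rewrite mulfV // toCM ofCK toC_nat toC1 INR_IZR_INZ /=.
by field.
Qed.

Lemma ev_cubic (x y : C) : ev (cubic (ofC x)) y = cubicP x y.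
Proof.
rewrite /cubic !evM !evD !evN !evX evC -[1]/(ofC (RtoC (IZR 1))) evC /cubicP.
by rewrite /Cminus.
Qed.

Lemma ev_cubic' (x y : C) : ev (cubic (ofC x))^`() y = cubicP1 x y.
Proof.
apply: (der_unique (ev (cubic (ofC x))) y); first exact: der_ev.
apply: (der_ext_loc (cubicP x)); last exact: der_cubicP.
by apply: filter_forall => w; rewrite ev_cubic.
Qed.

Lemma root_cubic (x r : C) : cubicP x r = RtoC (IZR 0) -> root (cubic (ofC x)) (ofC r).
Proof. by move=> H; apply/eqP; apply: (can_inj toCK); rewrite -[LHS]/(ev _ r) ev_cubic H. Qed.

Lemma ev_prolong (x y : C) k c :
  ev (prolong (cubic (ofC x)) k c) y =
    (cubicP x y * ev k^`() y + toC c * cubicP1 x y * ev k y)%C.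
Proof.
rewrite -ev_cubic -ev_cubic'; move: (cubic _) => P.
by rewrite /prolong evD !evM -{1}[c]toCK evC.
Qed.

Definition slope1 (x : C) (k0 : {poly complex R}) (m : nat) := prolong1 (cubic (ofC x)) k0 m%:R.
Definition slope2 (x : C) (k0 : {poly complex R}) (m : nat) := prolong2 (cubic (ofC x)) k0 m%:R.
Definition slope3 (x : C) (k0 : {poly complex R}) (m : nat) := prolong3 (cubic (ofC x)) k0 m%:R.
Definition slope_pivot (x : C) (k0 : {poly complex R}) (m : nat) := pivot (cubic (ofC x)) k0 m%:R.
Definition slope_numerator (x : C) (k0 : {poly complex R}) (m : nat) :=
  numerator (cubic (ofC x)) k0 m%:R.
Definition slope_denominator (x : C) (k0 : {poly complex R}) (m : nat) :=
  cubic (ofC x) * slope_pivot x k0 m.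

Lemma ev_numerator (x y : C) k0 m :
  ev (slope_numerator x k0 m) y =
  (RtoC (IZR 24) * ev (slope1 x k0 m) y * ev (slope2 x k0 m) y
   - RtoC (IZR 15) * ev k0 y * ev (slope3 x k0 m) y)%C.
Proof. by rewrite /slope_numerator /slope1 /slope2 /slope3 /numerator evD evN !evM !ev_nat !INR_IZR_INZ. Qed.

Lemma ev_denominator (x y : C) k0 m :
  ev (slope_denominator x k0 m) y =
  (cubicP x y * (RtoC (IZR 216) * ev (slope1 x k0 m) y ^ 2
   - RtoC (IZR 165) * ev k0 y * ev (slope2 x k0 m) y))%C.
Proof.
rewrite -ev_cubic /slope_denominator /slope_pivot /slope1 /slope2 /pivot; move: (cubic _) => P /=.
rewrite evM evD evN !evM !ev_nat !INR_IZR_INZ.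
by rewrite /= /Cminus Cmult_1_r.
Qed.

(** Here a = N / D, whereas [no_rational_solution] concerns 1 / a; numerator and denominator
    therefore trade places. *)
Lemma no_rational_slope (x y0 : C) (d : R) (N D : {poly complex R}) :
  x <> RtoC (IZR 0) -> x <> RtoC (IZR 1) -> Rlt (IZR 0) d -> ~ (forall y, ev N y = RtoC (IZR 0)) ->
  (forall y, Rlt (Cmod (y - y0)%C) d ->
   (RtoC (IZR 2) * cubicP x y * (ev D^`() y * ev N y - ev D y * ev N^`() y)
    = cubicP1 x y * ev D y * ev N y - RtoC (IZR 2) * cubicP x y * ev N y ^ 2)%C) -> False.
Proof.
move=> x0 x1 d0 N0 H.
apply: (@no_rational_solution _ (ofC x) D N).
- by apply/eqP => e; apply: x0; rewrite -[x]ofCK e.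
- by apply/eqP => e; apply: x1; rewrite -[x]ofCK e.
- by apply/eqP => e; apply: N0 => y; rewrite e ev_0.
apply/eqP; rewrite -subr_eq0; apply/eqP.
apply: (ev_eq0_on_disc _ y0 d d0) => y Hy; have {H} := H y Hy.
rewrite -ev_cubic -ev_cubic'; move: (cubic _) => P H.
rewrite !(ev_nat, evD, evN, evM) !INR_IZR_INZ /=; move: H; rewrite /= Cmult_1_r /Cminus => ->.
exact: Cplus_opp_r.
Qed.

Lemma slope_denominator_product (x y0 : C) (d : R) (q k0 : {poly complex R}) (m : nat) : Rlt (IZR 0) d ->
  (forall y, Rlt (Cmod (y - y0)%C) d ->
    (ev q y * ev (slope_denominator x k0 m) y ^ 2)%C = RtoC (IZR 0)) ->
  (forall y, ev q y = RtoC (IZR 0)) \/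
  (forall y, ev (slope_pivot x k0 m) y = RtoC (IZR 0)).
Proof.
move=> d0 H; have : q * slope_denominator x k0 m ^+ 2 = 0.
  by apply: (ev_eq0_on_disc _ y0 d d0) => y Hy; rewrite -[RHS](H y Hy) !evM /= Cmult_1_r.
move=> /eqP; rewrite mulf_eq0 => /orP[/eqP-> | ]; first by left=> y; rewrite ev_0.
have /negPf P0 := monic_neq0 (cubic_monic (ofC x)).
rewrite expf_eq0 /= /slope_denominator; move: P0; move: {1 2}(cubic _) => P P0.
by rewrite mulf_eq0 P0 => /eqP->; right=> y; rewrite ev_0.
Qed.

(** For exponent 0 the value of [slope2] at a root of the cubic is 0 whatever k0 is, so roots detect
    nothing. But then the term in P' is absent and [slope2] is the cubic times the derivative of
    [slope1]. *)
Lemma prolong2_exponent0 (x : C) (k0 : {poly complex R}) :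
  (forall y, ev (slope2 x k0 0) y = RtoC (IZR 0)) ->
  forall y, ev (slope1 x k0 0)^`() y = RtoC (IZR 0).
Proof.
move=> H y; set k1 := slope1 _ _ _.
have : cubic (ofC x) * k1^`() = 0.
  rewrite -[RHS](ev_eq0_on_disc _ (RtoC (IZR 0)) _ Rlt_0_1 (fun z _ => H z)).
  by rewrite /slope2 /prolong2 -/(slope1 x k0 0) -/k1 /prolong oppr0 polyC0 !mul0r addr0.
have /negPf P0 := monic_neq0 (cubic_monic (ofC x)).
move: P0; move: {1 2}(cubic _) => P P0 /eqP; rewrite mulf_eq0 P0 => /eqP ->.
by rewrite ev_0.
Qed.

Lemma ev_prolong1 (x y : C) k0 m : ev (slope1 x k0 m) y =
  (cubicP x y * ev k0^`() y + (RtoC (IZR 1) / RtoC (IZR 2) - RtoC (INR m)) * cubicP1 x y * ev k0 y)%C.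
Proof. by rewrite /slope1 /prolong1 ev_prolong toCD toCN toC_half toC_nat. Qed.

Lemma ev_prolong2 (x y : C) k0 m : ev (slope2 x k0 m) y =
  (cubicP x y * ev (slope1 x k0 m)^`() y
   + (- RtoC (INR m)) * cubicP1 x y * ev (slope1 x k0 m) y)%C.
Proof. by rewrite {1}/slope2 /prolong2 ev_prolong toCN toC_nat. Qed.

Lemma ev_prolong3 (x y : C) k0 m : ev (slope3 x k0 m) y =
  (cubicP x y * ev (slope2 x k0 m)^`() y
   + (- (RtoC (IZR 1) / RtoC (IZR 2)) - RtoC (INR m)) * cubicP1 x y
     * ev (slope2 x k0 m) y)%C.
Proof. by rewrite {1}/slope3 /prolong3 ev_prolong toCD !toCN toC_half toC_nat. Qed.

Definition polynomial_function (f : C -> C) := exists p : {poly complex R}, forall z, ev p z = f z.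

Lemma polynomial_const c : polynomial_function (fun _ => c).
Proof. by exists (ofC c)%:P => z; rewrite evC. Qed.
Lemma polynomial_id : polynomial_function (fun z => z).
Proof. by exists 'X => z; rewrite evX. Qed.
Lemma polynomial_plus f g :
  polynomial_function f -> polynomial_function g -> polynomial_function (fun z => f z + g z)%C.
Proof. by move=> [p fp] [q gq]; exists (p + q) => z; rewrite evD fp gq. Qed.
Lemma polynomial_minus f g :
  polynomial_function f -> polynomial_function g -> polynomial_function (fun z => f z - g z)%C.
Proof. by move=> [p fp] [q gq]; exists (p - q) => z; rewrite evD evN fp gq. Qed.
Lemma polynomial_mult f g :
  polynomial_function f -> polynomial_function g -> polynomial_function (fun z => f z * g z)%C.
Proof. by move=> [p fp] [q gq]; exists (p * q) => z; rewrite evM fp gq. Qed.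
Lemma polynomial_pow f n : polynomial_function f -> polynomial_function (fun z => f z ^ n)%C.
Proof.
move=> Hf; elim: n => [|n IH] /=; first exact: polynomial_const.
exact: polynomial_mult.
Qed.

Lemma ev_prolong2_root (x r : C) k0 m : cubicP x r = RtoC (IZR 0) ->
  ev (slope2 x k0 m) r =
  (- RtoC (INR m) * (RtoC (IZR 1) / RtoC (IZR 2) - RtoC (INR m)) * cubicP1 x r ^ 2 * ev k0 r)%C.
Proof.
move=> /root_cubic Pr; rewrite -ev_cubic' /ev /slope2 prolong2_at_root //.
by rewrite !(toCM, toCN, toCD) toC_half toC_nat /= Cmult_1_r.
Qed.

Lemma ev_pivot_root (x r : C) k0 m : cubicP x r = RtoC (IZR 0) ->
  ev (slope_pivot x k0 m) r =
  ((RtoC (IZR 1) / RtoC (IZR 2) - RtoC (INR m)) * (RtoC (IZR 108) - RtoC (IZR 51) * RtoC (INR m)) *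
    cubicP1 x r ^ 2 * ev k0 r ^ 2)%C.
Proof.
move=> /root_cubic Pr; rewrite -ev_cubic' /ev /slope_pivot pivot_at_root //.
rewrite !(toC_nat, toCM, toCN, toCD) toC_half (INR_IZR_INZ 108) (INR_IZR_INZ 51) /= !Cmult_1_r.
by [].
Qed.

End PolynomialContradiction.

Import RiccatiRational Evaluation PolynomialContradiction.

(** * Exclusion of a solution when the elimination is nondegenerate *)

Lemma no_riccati_slope (x y0 : C) (d : R) (m : nat) (k0 : poly.polynomial _) (G a T K1 : C -> C) :
  (0 < d)%R -> (forall y, (Cmod (y - y0) < d)%R -> Omega (x, y)) ->
  (forall y, (Cmod (y - y0) < d)%R -> G y <> 0) ->
  (forall y, (Cmod (y - y0) < d)%R -> der G y (- 2 * INR m * p6C x y * G y)) ->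
  (forall y, (Cmod (y - y0) < d)%R -> der a y (a y ^ 2 - p6C x y * a y)) ->
  (forall y, (Cmod (y - y0) < d)%R -> der T y ((3 * a y - p6C x y) * T y)) ->
  (forall y, (Cmod (y - y0) < d)%R -> der (fun t => ev k0 t * G t) y (K1 y)) ->
  (forall y, (Cmod (y - y0) < d)%R ->
    6 * T y ^ 2 = K1 y + p6C x y * (ev k0 y * G y) - 3 * a y * (ev k0 y * G y)) ->
  ~ (forall y, ev (slope2 x k0 m) y = 0) -> ~ (forall y, ev (slope_pivot x k0 m) y = 0) -> False.
Proof.
intros d0 HO HG dG da dT dK sq n2 n0.
set (p1 := ev (slope1 x k0 m)); set (p2 := ev (slope2 x k0 m)); set (p3 := ev (slope3 x k0 m)).
set (q0 := ev (poly.deriv k0)); set (q1 := ev (poly.deriv (slope1 x k0 m))).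
set (q2 := ev (poly.deriv (slope2 x k0 m))).
assert (r1 : forall y, (Cmod (y - y0) < d)%R ->
  p1 y = cubicP x y * q0 y + (1 / 2 - INR m) * cubicP1 x y * ev k0 y).
{ intros y _; apply ev_prolong1. }
assert (r2 : forall y, (Cmod (y - y0) < d)%R ->
  p2 y = cubicP x y * q1 y + (- INR m) * cubicP1 x y * p1 y).
{ intros y _; apply ev_prolong2. }
assert (r3 : forall y, (Cmod (y - y0) < d)%R ->
  p3 y = cubicP x y * q2 y + (- (1 / 2) - INR m) * cubicP1 x y * p2 y).
{ intros y _; apply ev_prolong3. }
set (Nf := slope_numerator x k0 m); set (Df := slope_denominator x k0 m).
assert (aD : forall y, (Cmod (y - y0) < d)%R -> a y * ev Df y = ev Nf y).
{ intros y Hy; unfold Nf, Df; rewrite ev_numerator, ev_denominator.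
  pose proof (slope_rational x y0 d (INR m) (ev k0) q0 p1 q1 p2 q2 p3 G a T K1 HO HG dG da dT
    (fun t _ => der_ev k0 t) (fun t _ => der_ev (slope1 x k0 m) t) (fun t _ => der_ev (slope2 x k0 m) t)
    r1 r2 r3 dK sq y Hy) as e.
  fold p1 p2 p3; rewrite <- e; ring. }
assert (x01 : x <> 0 /\ x <> 1).
{ assert (Z : (Cmod (y0 - y0) < d)%R).
  { replace (y0 - y0) with (RtoC 0) by ring; rewrite Cmod_0; exact d0. }
  destruct (Omega_neq _ _ (HO y0 Z)) as (x_0 & _ & x_1 & _); split; [exact x_0|].
  intros e; apply x_1; rewrite e; ring. }
destruct (classic (forall y, ev Nf y = 0)) as [N0|N0].
(* With zero numerator, a D = 0 on the disc, so [slope_vanishing] makes slope2 * D^2 vanish;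
   polynomials have no zero divisors, and both factors are excluded. *)
- destruct (slope_denominator_product x y0 d (slope2 x k0 m) k0 m d0) as [z|z]; [|exact (n2 z)|exact (n0 z)].
  apply (slope_vanishing x y0 d (INR m) (ev k0) q0 p1 q1 p2 G a T K1 HO HG dG da dT
    (fun t _ => der_ev k0 t) (fun t _ => der_ev (slope1 x k0 m) t) r1 r2 dK sq).
  intros y Hy; change (a y * ev Df y = 0); rewrite (aD y Hy); apply N0.
- apply (no_rational_slope x y0 d Nf Df (proj1 x01) (proj2 x01) d0 N0).
  exact (slope_quotient x y0 d a HO da (ev Nf) (ev Df) (ev (poly.deriv Nf)) (ev (poly.deriv Df)) aD
    (fun t _ => der_ev Nf t) (fun t _ => der_ev Df t)).
Qed.

(** * Parameters forced by a solution on a vertical line *)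

Ltac polynomial_step :=
  lazymatch goal with
  | |- polynomial_function (fun _ => ?c) => apply polynomial_const
  | |- polynomial_function (fun z => z) => apply polynomial_id
  | |- polynomial_function (fun z => @?f z + @?g z) => apply (polynomial_plus f g)
  | |- polynomial_function (fun z => @?f z - @?g z) => apply (polynomial_minus f g)
  | |- polynomial_function (fun z => @?f z * @?g z) => apply (polynomial_mult f g)
  | |- polynomial_function (fun z => @?f z ^ ?n) => apply (polynomial_pow f)
  end.

Section PainleveSlope.
Variables (al be ga de x y0 : C) (d : R) (a T : C -> C).
Hypothesis d0 : (0 < d)%R.
Hypothesis disc_Omega : forall y, (Cmod (y - y0) < d)%R -> Omega (x, y).
Hypothesis der_a : forall y, (Cmod (y - y0) < d)%R -> der a y (a y ^ 2 - p6C x y * a y).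
Hypothesis der_T : forall y, (Cmod (y - y0) < d)%R -> der T y ((3 * a y - p6C x y) * T y).
Hypothesis square_relation : forall y, (Cmod (y - y0) < d)%R ->
  6 * T y ^ 2 = p6K1 al be ga de x y + p6C x y * p6K al be ga de x y - 3 * a y * p6K al be ga de x y.

Let x_neq : x <> 0 /\ x - 1 <> 0.
Proof.
assert (Z : (Cmod (y0 - y0) < d)%R).
{ replace (y0 - y0) with (RtoC 0) by ring; rewrite Cmod_0; exact d0. }
destruct (Omega_neq _ _ (disc_Omega y0 Z)) as (x_0 & _ & x_1 & _); split; assumption.
Qed.

Let factored (m : nat) (k0 : poly.polynomial _) (G : C -> C) :
  (forall y, (Cmod (y - y0) < d)%R -> G y <> 0) ->
  (forall y, (Cmod (y - y0) < d)%R -> der G y (- 2 * INR m * p6C x y * G y)) ->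
  (forall y, (Cmod (y - y0) < d)%R -> p6K al be ga de x y = ev k0 y * G y) ->
  ~ (forall y, ev (slope2 x k0 m) y = 0) -> ~ (forall y, ev (slope_pivot x k0 m) y = 0) -> False.
Proof.
intros HG dG eK.
apply (no_riccati_slope x y0 d m k0 G a T (p6K1 al be ga de x)); try assumption.
- intros y Hy; apply (der_ext_loc (p6K al be ga de x)); [|apply der_p6K, disc_Omega, Hy].
  apply locally_Cmod; exists (d - Cmod (y - y0))%R; split; [lra|]; intros w Hw; apply eK.
  replace (w - y0) with ((w - y) + (y - y0)) by ring.
  eapply Rle_lt_trans; [apply Cmod_triangle|lra].
- intros y Hy; rewrite <- (eK y Hy); exact (square_relation y Hy).
Qed.

(* [P^3 K], up to the constant [x^2 (x-1)^2] *)
Let pole_poly (y : C) : C :=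
  1 / 2 * al * cubicP2 x y * cubicP x y ^ 3
  + be * x * (((y - 1) * (y - x)) ^ 3 *
      (3 * ((y - 1) * (y - x)) - 2 * y * (2 * y - 1 - x) + y ^ 2))
  + ga * (x - 1) * ((y * (y - x)) ^ 3 *
      (3 * (y * (y - x)) - 2 * (y - 1) * (2 * y - x) + (y - 1) ^ 2))
  + (de - 1 / 2) * x * (x - 1) * ((y * (y - 1)) ^ 3 *
      (3 * (y * (y - 1)) - 2 * (y - x) * (2 * y - 1) + (y - x) ^ 2)).

(** For exponent 3, [slope2] and the pivot at r equal 15/2 P'(r)^2 k0(r) and 225/2 P'(r)^2 k0(r)^2.
    A nonzero k0(r) would thus make the elimination nondegenerate. *)
Let pole_poly_root (r : C) : cubicP x r = 0 -> cubicP1 x r <> 0 -> pole_poly r = 0.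
Proof.
intros Pr P1r; apply NNPP; intros kr; destruct x_neq as [x_0 x_1].
assert (poly_k : polynomial_function pole_poly)
  by (unfold pole_poly, cubicP, cubicP2; repeat polynomial_step).
destruct poly_k as [k0 ek].
(* The exponent is 3 because [p6R2] has poles of order 4 and is multiplied by the cubic, which has
   simple zeros. *)
apply (factored 3 k0 (fun y => 1 / (x ^ 2 * (x - 1) ^ 2 * cubicP x y ^ 3))).
- intros y Hy; destruct (Omega_neq _ _ (disc_Omega y Hy)) as (? & ? & ? & ? & ?).
  assert (cubicP x y <> 0) by (unfold cubicP; nonzero).
  intros e; assert (z : 1 / (x ^ 2 * (x - 1) ^ 2 * cubicP x y ^ 3) * (x ^ 2 * (x - 1) ^ 2 * cubicP x y ^ 3) = 1)
    by (field; nonzero).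
  rewrite e in z; apply C1_nz; rewrite <- z; ring.
- intros y Hy; destruct (Omega_neq _ _ (disc_Omega y Hy)) as (? & ? & ? & ? & ?).
  assert (cubicP x y <> 0) by (unfold cubicP; nonzero).
  pose proof (der_cubicP x y) as Py; rewrite (cubicP1_eq x y (disc_Omega y Hy)) in Py.
  derive; nonzero; field; nonzero.
- intros y Hy; destruct (Omega_neq _ _ (disc_Omega y Hy)) as (? & ? & ? & ? & ?).
  rewrite ek; unfold pole_poly, p6K, p6R, p6R1, p6R2, cubicP, cubicP1, cubicP2; field; nonzero.
- intros z; specialize (z r); rewrite (ev_prolong2_root x r k0 3 Pr), ek in z.
  cbn [INR] in z; rewrite ?RtoC_plus in z.
  assert (z2 : cubicP1 x r ^ 2 * pole_poly r = 0).
  { transitivity (2 / 15 * (- (1 + 1 + 1) * (1 / 2 - (1 + 1 + 1)) * cubicP1 x r ^ 2 * pole_poly r));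
      [field|rewrite z; ring]. }
  revert z2; nonzero.
- intros z; specialize (z r); rewrite (ev_pivot_root x r k0 3 Pr), ek in z.
  cbn [INR] in z; rewrite ?RtoC_plus in z.
  assert (z2 : cubicP1 x r ^ 2 * pole_poly r ^ 2 = 0).
  { transitivity (2 / 225 * ((1 / 2 - (1 + 1 + 1)) * (108 - 51 * (1 + 1 + 1)) * cubicP1 x r ^ 2 * pole_poly r ^ 2));
      [field|rewrite z; ring]. }
  revert z2; nonzero.
Qed.

Let cancel (u v : C) : u <> 0 -> u * v = 0 -> v = 0.
Proof. intros u0 e; apply NNPP; intros v0; revert e; apply Cmult_neq_0; assumption. Qed.

(** At 0, 1 and x only the summand of [pole_poly] with its pole at that point survives, which
    isolates one parameter at a time. *)
Lemma double_pole_parameters : be = 0 /\ ga = 0 /\ de = 1 / 2.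
Proof.
destruct x_neq as [x_0 x_1].
assert (x_1' : 1 - x <> 0).
{ intros e; apply x_1; replace (x - 1) with (- (1 - x)) by ring; rewrite e; ring. }
repeat split.
- apply (cancel (3 * x ^ 5)); [nonzero|].
  transitivity (pole_poly 0); [unfold pole_poly, cubicP, cubicP2; ring|].
  apply pole_poly_root; [unfold cubicP; ring|].
  replace (cubicP1 x 0) with x by (unfold cubicP1; ring); exact x_0.
- apply (cancel (3 * (x - 1) * (1 - x) ^ 4)); [nonzero|].
  transitivity (pole_poly 1); [unfold pole_poly, cubicP, cubicP2; ring|].
  apply pole_poly_root; [unfold cubicP; ring|].
  replace (cubicP1 x 1) with (1 - x) by (unfold cubicP1; ring); exact x_1'.
- assert (e : de - 1 / 2 = 0).
  { apply (cancel (3 * (x * (x - 1)) ^ 5)); [nonzero|].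
    transitivity (pole_poly x); [unfold pole_poly, cubicP, cubicP2; ring|].
    apply pole_poly_root; [unfold cubicP; ring|].
    replace (cubicP1 x x) with (x * (x - 1)) by (unfold cubicP1; ring); nonzero. }
  replace de with (de - 1 / 2 + 1 / 2) by ring; rewrite e; ring.
Qed.

(** Without double poles, K is al (3 y - (1 + x)) divided by x^2 (x - 1)^2, a polynomial in y, so
    the exponent is 0. This is the contribution of infinity. *)
Lemma leading_parameter : al = 0.
Proof.
destruct double_pole_parameters as (eb & eg & ed); destruct x_neq as [x_0 x_1].
apply NNPP; intros al0.
assert (poly_k : polynomial_function (fun y => al * (3 * y - (1 + x)))) by repeat polynomial_step.
destruct poly_k as [k0 ek].
assert (dk : forall y, ev (poly.deriv k0) y = 3 * al).
{ intros y; apply (der_unique (ev k0) y); [apply der_ev|].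
  apply (der_ext_loc (fun t => al * (3 * t - (1 + x)))).
  - apply filter_forall; intros t; symmetry; apply ek.
  - derive; ring. }
assert (dk1 : forall y, ev (poly.deriv (slope1 x k0 0)) y =
  al * (9 / 2 * cubicP1 x y + (3 * y - (1 + x)) ^ 2)).
{ intros y; apply (der_unique (ev (slope1 x k0 0)) y); [apply der_ev|].
  apply (der_ext_loc (fun t => cubicP x t * (3 * al) + 1 / 2 * cubicP1 x t * (al * (3 * t - (1 + x))))).
  - apply filter_forall; intros t; rewrite ev_prolong1, dk, ek; cbn [INR]; ring.
  - pose proof (der_cubicP x y); pose proof (der_cubicP1 x y); derive; unfold cubicP2; field. }
apply (factored 0 k0 (fun _ => 1 / (x ^ 2 * (x - 1) ^ 2))).
- intros y _ e; assert (z : 1 / (x ^ 2 * (x - 1) ^ 2) * (x ^ 2 * (x - 1) ^ 2) = 1) by (field; nonzero).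
  rewrite e in z; apply C1_nz; rewrite <- z; ring.
- intros y _; derive; ring.
- intros y Hy; destruct (Omega_neq _ _ (disc_Omega y Hy)) as (? & ? & ? & ? & ?).
  rewrite ek; unfold p6K, p6R, p6R1, p6R2, cubicP, cubicP1, cubicP2; rewrite eb, eg, ed; field; nonzero.
- intros z; pose proof (prolong2_exponent0 x k0 z) as f.
  pose proof (f 0) as f0; pose proof (f 1) as f1; pose proof (f (-(1))) as f2.
  rewrite dk1 in f0, f1, f2.
  (* Second difference of a quadratic polynomial in y with leading coefficient 45/2 al. *)
  assert (e : 45 * al = 0).
  { transitivity (al * (9 / 2 * cubicP1 x 1 + (3 * 1 - (1 + x)) ^ 2)
      + al * (9 / 2 * cubicP1 x (-(1)) + (3 * -(1) - (1 + x)) ^ 2)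
      - 2 * (al * (9 / 2 * cubicP1 x 0 + (3 * 0 - (1 + x)) ^ 2))).
    - unfold cubicP1; field.
    - rewrite f0, f1, f2; ring. }
  revert e; nonzero.
- intros z.
  (* The pivot at a root is 54 P'(r)^2 k0(r)^2, and the linear k0 cannot vanish at both 0 and 1. *)
  assert (nz : forall r, cubicP x r = 0 -> cubicP1 x r <> 0 -> 3 * r - (1 + x) = 0).
  { intros r Pr P1r; specialize (z r); rewrite (ev_pivot_root x r k0 0 Pr), ek in z.
    cbn [INR] in z.
    assert (z2 : (cubicP1 x r ^ 2 * al ^ 2) * ((3 * r - (1 + x)) * (3 * r - (1 + x))) = 0).
    { transitivity (1 / 54 * ((1 / 2 - 0) * (108 - 51 * 0) * cubicP1 x r ^ 2 * (al * (3 * r - (1 + x))) ^ 2));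
        [field|rewrite z; ring]. }
    apply cancel in z2; [|nonzero].
    apply NNPP; intros n; revert z2; nonzero. }
  assert (e0 : 3 * 0 - (1 + x) = 0).
  { apply nz; [unfold cubicP; ring|].
    replace (cubicP1 x 0) with x by (unfold cubicP1; ring); exact x_0. }
  assert (e1 : 3 * 1 - (1 + x) = 0).
  { apply nz; [unfold cubicP; ring|].
    replace (cubicP1 x 1) with (-(1) * (x - 1)) by (unfold cubicP1; ring); nonzero.
    intros e; apply C1_nz; replace (RtoC 1) with (- -(1)) by ring; rewrite e; ring. }
  assert (e3 : RtoC 3 = 0).
  { transitivity ((3 * 1 - (1 + x)) - (3 * 0 - (1 + x))); [ring|rewrite e0, e1; ring]. }
  revert e3; nonzero.
Qed.

End PainleveSlope.

(** * From vertical lines to open sets *)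

Section Obstruction.
Variables al be ga de : C.

Lemma regular_foliation_parameters (U : C * C -> Prop) (a c s : C * C -> C) (p : C * C) :
  open U -> (forall q, U q -> Omega q) -> U p ->
  (forall q, U q -> dy a q (a q ^ 2 - p6C (fst q) (snd q) * a q)) ->
  (forall q, U q -> dx a q (s q)) ->
  (forall q, U q -> dx c q (p6W al be ga de (fst q) (snd q) + p6B (fst q) (snd q) * c q - c q ^ 2
                            + a q * p6A al be ga de (fst q) (snd q))) ->
  (forall q, U q -> dy c q (s q + 2 * a q * c q + p6E (fst q) (snd q))) ->
  (forall q, U q -> tends (locally q) a (a q)) ->
  (forall q, U q -> tends (locally q) c (c q)) ->
  (forall q, U q -> dy (fun r => s r + a r * c r) q
     ((3 * a q - p6C (fst q) (snd q)) * (s q + a q * c q))) ->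
  (forall q, U q -> tends (locally q) (fun r => s r + a r * c r) (s q + a q * c q)) ->
  al = 0 /\ be = 0 /\ ga = 0 /\ de = 1 / 2.
Proof.
intros oU UO Up ay ax cx cy ta tc Ty tT.
destruct p as [x y0].
pose proof (locally_slice_y _ _ _ (oU _ Up)) as L; apply locally_Cmod in L.
destruct L as [d [d0 L]].
assert (sq : forall y, (Cmod (y - y0) < d)%R -> 6 * (s (x, y) + a (x, y) * c (x, y)) ^ 2 =
   p6K1 al be ga de x y + p6C x y * p6K al be ga de x y - 3 * a (x, y) * p6K al be ga de x y).
{ intros y Hy.
  exact (prolongation_compatibility al be ga de U a c s oU UO ay ax cx cy ta tc Ty tT (x, y) (L y Hy)). }
assert (HO : forall y, (Cmod (y - y0) < d)%R -> Omega (x, y)) by (intros y Hy; exact (UO _ (L y Hy))).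
assert (day : forall y, (Cmod (y - y0) < d)%R -> der (fun t => a (x, t)) y (a (x, y) ^ 2 - p6C x y * a (x, y)))
  by (intros y Hy; exact (ay _ (L y Hy))).
assert (dTy : forall y, (Cmod (y - y0) < d)%R ->
  der (fun t => s (x, t) + a (x, t) * c (x, t)) y ((3 * a (x, y) - p6C x y) * (s (x, y) + a (x, y) * c (x, y))))
  by (intros y Hy; exact (Ty _ (L y Hy))).
split.
- exact (leading_parameter al be ga de x y0 d (fun t => a (x, t)) (fun t => s (x, t) + a (x, t) * c (x, t)) d0 HO day dTy sq).
- exact (double_pole_parameters al be ga de x y0 d (fun t => a (x, t)) (fun t => s (x, t) + a (x, t) * c (x, t)) d0 HO day dTy sq).
Qed.

(** The regularity of [T] is proved only where [a] is nonzero. If there is such a point, U is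
    replaced by the open set of all of them; otherwise [a], [s] and [T] vanish on U and the
    regularity is trivial. *)
Lemma foliation_parameters (U : C * C -> Prop) (a c s : C * C -> C) (p : C * C) :
  open U -> (forall q, U q -> Omega q) -> U p ->
  (forall q, U q -> dy a q (a q ^ 2 - p6C (fst q) (snd q) * a q)) ->
  (forall q, U q -> dx a q (s q)) ->
  (forall q, U q -> dx c q (p6W al be ga de (fst q) (snd q) + p6B (fst q) (snd q) * c q - c q ^ 2
                            + a q * p6A al be ga de (fst q) (snd q))) ->
  (forall q, U q -> dy c q (s q + 2 * a q * c q + p6E (fst q) (snd q))) ->
  (forall q, U q -> tends (locally q) a (a q)) ->
  (forall q, U q -> tends (locally q) c (c q)) ->
  al = 0 /\ be = 0 /\ ga = 0 /\ de = 1 / 2.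
Proof.
intros oU UO Up ay ax cx cy ta tc.
destruct (classic (exists q, U q /\ a q <> 0)) as [[q [Uq aq]]|none].
- set (V := fun r => U r /\ a r <> 0).
  assert (oV : open V).
  { intros r [Ur ar]; apply filter_and; [exact (oU r Ur)|exact (tends_neq _ _ ar (ta r Ur))]. }
  assert (reg : forall r, V r ->
    dy (fun t => s t + a t * c t) r ((3 * a r - p6C (fst r) (snd r)) * (s r + a r * c r)) /\
    tends (locally r) (fun t => s t + a t * c t) (s r + a r * c r)).
  { intros [x y] [Ur ar].
    exact (regularity_nonzero U a c s oU UO ay ax cy ta tc x y Ur ar). }
  apply (regular_foliation_parameters V a c s q oV); try (intros r [Ur ar]; auto; fail).
  + split; assumption.
  + intros r Vr; exact (proj1 (reg r Vr)).
  + intros r Vr; exact (proj2 (reg r Vr)).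
- assert (a0 : forall q, U q -> a q = 0).
  { intros q Uq; apply NNPP; intros n; apply none; exists q; split; assumption. }
  assert (s0 : forall q, U q -> s q = 0).
  { intros [x y] Uq; apply (der_unique _ _ _ _ (ax _ Uq)).
    apply (der_ext_loc (fun _ => RtoC 0)); [|apply der_const].
    pose proof (locally_slice_x _ _ _ (oU _ Uq)) as L; revert L; apply filter_imp.
    intros t Ut; symmetry; exact (a0 _ Ut). }
  assert (T0 : forall q, U q -> s q + a q * c q = 0) by (intros q Uq; rewrite (a0 q Uq), (s0 q Uq); ring).
  apply (regular_foliation_parameters U a c s p); try assumption.
  + intros [x y] Uq; rewrite (T0 _ Uq).
    apply (der_ext_loc (fun _ => RtoC 0)); [|eapply der_eq; [apply der_const|ring]].
    pose proof (locally_slice_y _ _ _ (oU _ Uq)) as L; revert L; apply filter_imp.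
    intros t Ut; symmetry; exact (T0 _ Ut).
  + intros q Uq; rewrite (T0 _ Uq); apply (tends_ext (fun _ => RtoC 0)); [|apply tends_const].
    generalize (oU _ Uq); apply filter_imp; intros t Ut; symmetry; exact (T0 _ Ut).
Qed.
End Obstruction.

(** * The differential system satisfied by the Riccati coefficients *)

(** C-linearity makes the differential on each axis a multiplication by its value on the basis
    vector, and the product norm restricts there to the modulus. *)
Lemma holomorphic_differential (f : C * C -> C) (p : C * C) :
  ex_filterdiff (K := C_AbsRing) f (locally p) ->
  exists l1 l2 : C, dx f p l1 /\ dy f p l2.
Proof.
destruct p as [x y]; intros [L [lin H]].
specialize (H (x, y) (fun P HP => HP)).
assert (lx : forall u : C, L (u, RtoC 0) = u * L (RtoC 1, RtoC 0)).
{ intros u; replace (u, RtoC 0) with (scal (K := C_AbsRing) u (RtoC 1, RtoC 0)).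
  - exact (linear_scal L lin u (RtoC 1, RtoC 0)).
  - change ((u * 1, u * 0) = (u, RtoC 0)); f_equal; ring. }
assert (ly : forall u : C, L (RtoC 0, u) = u * L (RtoC 0, RtoC 1)).
{ intros u; replace (RtoC 0, u) with (scal (K := C_AbsRing) u (RtoC 0, RtoC 1)).
  - exact (linear_scal L lin u (RtoC 0, RtoC 1)).
  - change ((u * 0, u * 1) = (RtoC 0, u)); f_equal; ring. }
exists (L (RtoC 1, RtoC 0)), (L (RtoC 0, RtoC 1)); split; intros eps He; cbn [fst snd].
- generalize (locally_slice_x _ _ _ (H (mkposreal eps He))); apply filter_imp; intros t Ht.
  change (Cmod ((f (t, y) - f (x, y)) - L ((t - x)%C, (y - y)%C))
    <= eps * sqrt (Cmod (t - x) ^ 2 + Cmod (y - y) ^ 2))%R in Ht.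
  replace (y - y) with (RtoC 0) in Ht by ring; rewrite lx, Cmod_0 in Ht.
  replace (Cmod (t - x) ^ 2 + 0 ^ 2)%R with (Cmod (t - x) ^ 2)%R in Ht by ring.
  rewrite sqrt_pow2 in Ht by apply Cmod_ge_0.
  replace (L (RtoC 1, RtoC 0) * (t - x)) with ((t - x) * L (RtoC 1, RtoC 0)) by ring; exact Ht.
- generalize (locally_slice_y _ _ _ (H (mkposreal eps He))); apply filter_imp; intros t Ht.
  change (Cmod ((f (x, t) - f (x, y)) - L ((x - x)%C, (t - y)%C))
    <= eps * sqrt (Cmod (x - x) ^ 2 + Cmod (t - y) ^ 2))%R in Ht.
  replace (x - x) with (RtoC 0) in Ht by ring; rewrite ly, Cmod_0 in Ht.
  replace (0 ^ 2 + Cmod (t - y) ^ 2)%R with (Cmod (t - y) ^ 2)%R in Ht by ring.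
  rewrite sqrt_pow2 in Ht by apply Cmod_ge_0.
  replace (L (RtoC 0, RtoC 1) * (t - y)) with ((t - y) * L (RtoC 0, RtoC 1)) by ring; exact Ht.
Qed.

Lemma holomorphic_tends (f : C * C -> C) (p : C * C) :
  ex_filterdiff (K := C_AbsRing) f (locally p) -> tends (locally p) f (f p).
Proof.
intros Hf; pose proof (filterdiff_continuous (K := C_AbsRing) (V := C_NormedModule)
  (U := prod_NormedModule C_AbsRing C_NormedModule C_NormedModule) f p Hf) as H; intros eps He.
apply (H (fun w => (Cmod (w - f p) < eps)%R)), locally_Cmod.
exists eps; split; [exact He|]; intros w Hw; exact Hw.
Qed.

(** The combinations are those of Lagrange interpolation at 0, 1, -1 and 2. *)
Lemma cubic_vanishing (u0 u1 u2 u3 : C) :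
  (forall z : C, u0 + u1 * z + u2 * z ^ 2 + u3 * z ^ 3 = 0) ->
  u0 = 0 /\ u1 = 0 /\ u2 = 0 /\ u3 = 0.
Proof.
intros H; pose proof (H 0) as e0; pose proof (H 1) as e1; pose proof (H (-(1))) as e2; pose proof (H 2) as e3.
repeat split.
- rewrite <- e0; ring.
- match type of e0 with ?w0 = _ => match type of e1 with ?w1 = _ => match type of e2 with ?w2 = _ =>
  match type of e3 with ?w3 = _ => transitivity (- (1 / 2) * w0 + w1 - 1 / 3 * w2 - 1 / 6 * w3);
    [field|rewrite e0, e1, e2, e3; field] end end end end.
- match type of e0 with ?w0 = _ => match type of e1 with ?w1 = _ => match type of e2 with ?w2 = _ =>
  transitivity (1 / 2 * w1 + 1 / 2 * w2 - w0);
    [field|rewrite e0, e1, e2; field] end end end.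
- match type of e0 with ?w0 = _ => match type of e1 with ?w1 = _ => match type of e2 with ?w2 = _ =>
  match type of e3 with ?w3 = _ => transitivity (1 / 2 * w0 - 1 / 2 * w1 - 1 / 6 * w2 + 1 / 6 * w3);
    [field|rewrite e0, e1, e2, e3; field] end end end end.
Qed.

(** The value of the Riccati form on the geodesic vector (1, z, rhs) is a cubic polynomial in z that
    vanishes for every z. *)
Lemma geodesic_coefficients (U : C * C -> Prop) (al0 be0 ga0 : one_form2) (Pi : projective_structure) (q : C * C) :
  cuts_geodesic_foliation U (riccati_form al0 be0 ga0) Pi -> U q ->
  coefA Pi q = form_dx ga0 q /\ coefB Pi q = form_dx be0 q + form_dy ga0 q /\
  coefC Pi q = form_dx al0 q + form_dy be0 q /\ coefD Pi q = form_dy al0 q.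
Proof.
intros cuts Uq.
destruct (cubic_vanishing (coefA Pi q - form_dx ga0 q) (coefB Pi q - (form_dx be0 q + form_dy ga0 q))
  (coefC Pi q - (form_dx al0 q + form_dy be0 q)) (coefD Pi q - form_dy al0 q)) as (e0 & e1 & e2 & e3).
{ intros z; destruct (cuts q z Uq (1 * RtoC 1, 1 * z, 1 * second_order_rhs Pi q z)) as [_ H].
  destruct H as [H _].
  { exists (RtoC 1); reflexivity. }
  rewrite <- H; unfold form3_eval, riccati_form, second_order_rhs; simpl; ring. }
assert (sub0 : forall u v : C, u - v = 0 -> u = v).
{ intros u v e; replace u with (u - v + v) by ring; rewrite e; ring. }
repeat split; apply sub0; assumption.
Qed.

(** These are the structure equations d alpha = alpha /\ beta, d beta = 2 alpha /\ gamma, d gamma =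
    beta /\ gamma of a flat sl2 connection, read off the powers of z in w /\ dw. *)
Lemma frobenius_coefficients (U : C * C -> Prop) (al0 be0 ga0 : one_form2) (x y : C)
    (al1_y be1_y ga1_y al2_x be2_x ga2_x : C) :
  frobenius_integrable_over U (riccati_form al0 be0 ga0) -> U (x, y) ->
  dy (form_dx al0) (x, y) al1_y -> dy (form_dx be0) (x, y) be1_y -> dy (form_dx ga0) (x, y) ga1_y ->
  dx (form_dy al0) (x, y) al2_x -> dx (form_dy be0) (x, y) be2_x -> dx (form_dy ga0) (x, y) ga2_x ->
  let p := (x, y) in
  al1_y - al2_x + form_dx al0 p * form_dy be0 p - form_dy al0 p * form_dx be0 p = 0 /\
  be1_y - be2_x + 2 * (form_dx al0 p * form_dy ga0 p - form_dy al0 p * form_dx ga0 p) = 0 /\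
  ga1_y - ga2_x + form_dx be0 p * form_dy ga0 p - form_dy be0 p * form_dx ga0 p = 0.
Proof.
intros frob Up dal1 dbe1 dga1 dal2 dbe2 dga2 p.
unfold dx, dy in *; cbn [fst snd] in *.
(* The z^3 terms of w /\ dw cancel, whence the last coefficient 0. *)
match goal with |- ?e2 = _ /\ ?e1 = _ /\ ?e0 = _ =>
  destruct (cubic_vanishing e0 e1 e2 0) as (z0 & z1 & z2 & _) end.
2: repeat split; assumption.
intros z; refine (eq_trans _ (frob (x, y) z Up)).
unfold wedge, exterior_derivative, partial_x, partial_y, partial_z, riccati_form; cbn [form3_dx form3_dy form3_dz form3_dxdy form3_dxdz form3_dydz].
rewrite (C_derive_der (fun _ => RtoC 1) x 0 (der_const _ _)), (C_derive_der (fun _ => RtoC 1) y 0 (der_const _ _)).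
rewrite (C_derive_der (fun t => - (form_dy al0 (t, y) * z ^ 2 + form_dy be0 (t, y) * z + form_dy ga0 (t, y))) x
  (- (al2_x * z ^ 2 + be2_x * z + ga2_x))) by (derive; ring).
rewrite (C_derive_der (fun t => - (form_dx al0 (x, t) * z ^ 2 + form_dx be0 (x, t) * z + form_dx ga0 (x, t))) y
  (- (al1_y * z ^ 2 + be1_y * z + ga1_y))) by (derive; ring).
rewrite (C_derive_der (fun t => - (form_dx al0 (x, y) * t ^ 2 + form_dx be0 (x, y) * t + form_dx ga0 (x, y))) z
  (- (form_dx al0 (x, y) * 2 * z + form_dx be0 (x, y)))) by (derive; ring).
rewrite (C_derive_der (fun t => - (form_dy al0 (x, y) * t ^ 2 + form_dy be0 (x, y) * t + form_dy ga0 (x, y))) z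
  (- (form_dy al0 (x, y) * 2 * z + form_dy be0 (x, y)))) by (derive; ring).
subst p; ring.
Qed.

Theorem proposition6p2 :
  forall alpha beta gamma delta : C,
    (alpha, beta, gamma, delta) <> picard_parameter ->
    ~ exists p : C * C, Omega p /\
        exists U : C * C -> Prop,
          open U /\ U p /\ (forall q, U q -> Omega q) /\
          foliated_on U (painleve6 alpha beta gamma delta).
Proof.
intros al be ga de nP (p & _ & U & oU & Up & UO & al0 & be0 & ga0 & [ha1 ha2] & [hb1 hb2] & [hc1 hc2] & frob & cuts).
apply nP.
pose proof (fun q => geodesic_coefficients _ _ _ _ _ q cuts) as coefs.
set (a := form_dx al0); set (c := form_dy ga0).
set (s := fun q : C * C => C_derive (fun t => a (t, snd q)) (fst q)).
assert (ax : forall q, U q -> dx a q (s q)).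
{ intros q Uq; destruct (holomorphic_differential a q (ha1 q Uq)) as (l & _ & H & _).
  unfold s; unfold dx in H; rewrite (C_derive_der _ _ _ H); exact H. }
assert (be2 : forall q, U q -> p6C (fst q) (snd q) - a q = form_dy be0 q).
{ intros [x y] Uq; destruct (coefs _ Uq) as (_ & _ & e & _).
  change (p6C x y = a (x, y) + form_dy be0 (x, y)) in e; cbn [fst snd]; rewrite e; ring. }
assert (be1 : forall q, U q -> p6B (fst q) (snd q) - c q = form_dx be0 q).
{ intros [x y] Uq; destruct (coefs _ Uq) as (_ & e & _).
  change (p6B x y = form_dx be0 (x, y) + c (x, y)) in e; cbn [fst snd]; rewrite e; ring. }
assert (ga1 : forall q, U q -> p6A al be ga de (fst q) (snd q) = form_dx ga0 q).
{ intros [x y] Uq; exact (proj1 (coefs _ Uq)). }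
assert (al2 : forall q, U q -> RtoC 0 = form_dy al0 q).
{ intros [x y] Uq; exact (proj2 (proj2 (proj2 (coefs _ Uq)))). }
assert (system : forall q, U q ->
  dy a q (a q ^ 2 - p6C (fst q) (snd q) * a q) /\
  dx c q (p6W al be ga de (fst q) (snd q) + p6B (fst q) (snd q) * c q - c q ^ 2
                            + a q * p6A al be ga de (fst q) (snd q)) /\
  dy c q (s q + 2 * a q * c q + p6E (fst q) (snd q))).
{ intros [x y] Uq; pose proof (UO _ Uq) as O.
  destruct (holomorphic_differential a _ (ha1 _ Uq)) as (_ & a_y & _ & day).
  destruct (holomorphic_differential c _ (hc2 _ Uq)) as (c_x & c_y & dcx & dcy).
  pose proof (ax _ Uq) as dax.
  pose proof (locally_slice_x _ _ _ (oU _ Uq)) as Lx; pose proof (locally_slice_y _ _ _ (oU _ Uq)) as Ly.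
  (* The coefficient identities hold on a slice around the point, so the derivatives needed here are
     those of explicit functions and of [a] and [c]. *)
  assert (d1 : dy (form_dx be0) (x, y) (2 * p6E x y - c_y)).
  { apply (der_ext_loc (fun t => p6B x t - c (x, t))).
    - revert Ly; apply filter_imp; intros t Ut; exact (be1 _ Ut).
    - apply der_minus; [exact (der_p6B x y O)|exact dcy]. }
  assert (d2 : dy (form_dx ga0) (x, y) (p6W al be ga de x y + p6C x y * p6A al be ga de x y)).
  { apply (der_ext_loc (fun t => p6A al be ga de x t)).
    - revert Ly; apply filter_imp; intros t Ut; exact (ga1 _ Ut).
    - exact (der_p6A al be ga de x y O). }
  assert (d3 : dx (form_dy al0) (x, y) 0).
  { apply (der_ext_loc (fun _ => RtoC 0)); [|apply der_const].
    revert Lx; apply filter_imp; intros t Ut; exact (al2 _ Ut). }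
  assert (d4 : dx (form_dy be0) (x, y) (p6E x y - s (x, y))).
  { apply (der_ext_loc (fun t => p6C t y - a (t, y))).
    - revert Lx; apply filter_imp; intros t Ut; exact (be2 _ Ut).
    - apply der_minus; [exact (der_p6C_x x y O)|exact dax]. }
  destruct (frobenius_coefficients U al0 be0 ga0 x y _ _ _ _ _ _ frob Uq day d1 d2 d3 d4 dcx) as (e2 & e1 & e0).
  assert (v1 : form_dy al0 (x, y) = 0) by (symmetry; exact (al2 _ Uq)).
  assert (v2 : form_dx be0 (x, y) = p6B x y - c (x, y)) by (symmetry; exact (be1 _ Uq)).
  assert (v3 : form_dy be0 (x, y) = p6C x y - a (x, y)) by (symmetry; exact (be2 _ Uq)).
  assert (v4 : form_dx ga0 (x, y) = p6A al be ga de x y) by (symmetry; exact (ga1 _ Uq)).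
  rewrite v2, v3, v4 in e0; rewrite v1, v4 in e1; rewrite v1, v2, v3 in e2.
  fold a c in e0, e1, e2; cbn [fst snd].
  repeat split.
  - eapply der_eq; [exact day|].
    match type of e2 with ?l = _ => transitivity (a_y - l); [rewrite e2; ring|ring] end.
  - eapply der_eq; [exact dcx|].
    match type of e0 with ?l = _ => transitivity (c_x + l); [rewrite e0; ring|ring] end.
  - eapply der_eq; [exact dcy|].
    match type of e1 with ?l = _ => transitivity (c_y + l); [rewrite e1; ring|ring] end. }
destruct (foliation_parameters al be ga de U a c s p oU UO Up) as (-> & -> & -> & ->).
- intros q Uq; exact (proj1 (system q Uq)).
- exact ax.
- intros q Uq; exact (proj1 (proj2 (system q Uq))).
- intros q Uq; exact (proj2 (proj2 (system q Uq))).
- intros q Uq; apply holomorphic_tends, ha1, Uq.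
- intros q Uq; apply holomorphic_tends, hc2, Uq.
- reflexivity.
Qed.
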